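(* Assume that $q>0$, or that $q=0$ and $K_1+k_1<K_2$. Let $y>1$ be the unique solution in $(1,\infty)$ of $f(y)=0$, where $$f(z)=\frac{K_2-k_1}{n_2-n_1}\left[n_2(1-n_1)z^{n_1}+n_1(n_2-1)z^{n_2}\right]+(K_1+k_1-K_2),$$ and let $a<b$ be defined by $$e^b=\frac{(K_2-k_1)n_1n_2}{n_2-n_1}\left[y^{n_1}-y^{n_2}\right],\qquad e^a=\frac{e^b}{y}.$$ Then $a<\ln K_1<b$, and the function $$V^\infty(x)=\begin{cases}K_2-k_1,&x<a,\\[2pt] \dfrac{K_2-k_1}{n_2-n_1}\left[n_2e^{n_1(x-a)}-n_1e^{n_2(x-a)}\right],&a\le x\le b,\\[4pt] e^x-K_1+K_2-k_1,&x>b,\end{cases}$$ is the unique strong solution of the uncapped stationary call-side problem. Its coincidence set $\{V^\infty=\psi_1\}$ is $(-\infty,a]\cup[b,\infty)$, and $V^\infty-\psi_1$ is strictly decreasing on $[\ln K_1,b]$.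
   Context: Constants: $0<K_1<k_1<k_2<K_2$, $\sigma>0$, $r>0$, $q\ge0$, and $1<p<\infty$. Put $\mathcal Lu:=\frac{\sigma^2}{2}u''+\left(r-q-\frac{\sigma^2}{2}\right)u'-ru$ and $\psi_1(x):=(e^x-K_1)^++K_2-k_1$. $n_1<0<n_2$ denote the roots of $\frac{\sigma^2}{2}n^2+\left(r-q-\frac{\sigma^2}{2}\right)n-r=0$. A strong solution of the uncapped stationary call-side problem is a function $V\in C(\mathbb R)\cap W^2_{p,\mathrm{loc}}(\mathbb R)$ (Sobolev space of functions with two weak derivatives in $L^p_{\mathrm{loc}}$) with $V\ge\psi_1$, $-\mathcal LV\ge0$ almost everywhere, $-\mathcal LV=0$ almost everywhere on $\{V>\psi_1\}$, and $\psi_1(x)\le V(x)\le e^x+K_2-k_1$ for all $x\in\mathbb R$. *)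

(* Defs.v *)
From HB Require Import structures.
From mathcomp Require Import all_boot all_order all_algebra.
From mathcomp Require Import all_classical all_reals all_analysis.

Set Implicit Arguments.
Unset Strict Implicit.
Unset Printing Implicit Defensive.
Import Order.TTheory GRing.Theory Num.Theory.
Import numFieldNormedType.Exports.

Local Open Scope classical_set_scope.
Local Open Scope ring_scope.

Section sobolev_loc.
Context {R : realType}.
Local Notation mu := (@lebesgue_measure R).

Definition test_function (phi : R -> R) : Prop :=
  (forall (n : nat) (x : R), derivable (derive1n n phi) x 1) /\
  compact (closure [set x | phi x != 0]).

(* Both integrands are integrable: u and g are locally integrable, and the
   derivatives of phi are bounded with compact support. *)
Definition weak_derivative (k : nat) (u g : R -> R) : Prop :=
  [/\ locally_integrable [set: R] u,
      locally_integrable [set: R] g &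
      forall phi, test_function phi ->
        \int[mu]_x (u x * derive1n k phi x) = (-1) ^+ k * \int[mu]_x (g x * phi x)].

(* Measurability is Borel measurability, which every class of almost
   everywhere equal functions can be represented by. *)
Definition Lp_loc (p : R) (f : R -> R) : Prop :=
  forall K : set R, compact K -> f \_ K \in Lfun mu p%:E.

(* u lies in W^2_{p,loc}, with u1 and u2 representing its first and second
   weak derivatives (which are unique up to almost everywhere equality). *)
Definition W2p_loc (p : R) (u u1 u2 : R -> R) : Prop :=
  [/\ Lp_loc p u, Lp_loc p u1, Lp_loc p u2,
      weak_derivative 1 u u1 & weak_derivative 2 u u2].

End sobolev_loc.

Section call_side.
Context {R : realType}.
Local Notation mu := (@lebesgue_measure R).

(* The operator L at x, with u1 and u2 in the role of u' and u''. *)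
Definition Lop (sigma r q : R) (u u1 u2 : R -> R) (x : R) : R :=
  sigma ^+ 2 / 2 * u2 x + (r - q - sigma ^+ 2 / 2) * u1 x - r * u x.

Definition char_poly_L (sigma r q n : R) : R :=
  sigma ^+ 2 / 2 * n ^+ 2 + (r - q - sigma ^+ 2 / 2) * n - r.

Definition psi1 (K1 k1 K2 : R) (x : R) : R :=
  Num.max (expR x - K1) 0 + K2 - k1.

Definition strong_solution (K1 k1 K2 sigma r q p : R) (V : R -> R) : Prop :=
  continuous V /\
  exists V1 V2 : R -> R,
    [/\ W2p_loc p V V1 V2,
        {ae mu, forall x, 0 <= - Lop sigma r q V V1 V2 x},
        {ae mu, forall x, psi1 K1 k1 K2 x < V x ->
                          - Lop sigma r q V V1 V2 x = 0} &
        forall x, psi1 K1 k1 K2 x <= V x <= expR x + K2 - k1].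

Definition f_y (K1 k1 K2 n1 n2 z : R) : R :=
  (K2 - k1) / (n2 - n1) *
    (n2 * (1 - n1) * z `^ n1 + n1 * (n2 - 1) * z `^ n2) + (K1 + k1 - K2).

Definition V_infty (K1 k1 K2 n1 n2 a b : R) (x : R) : R :=
  if x < a then K2 - k1
  else if x <= b then
    (K2 - k1) / (n2 - n1) *
      (n2 * expR (n1 * (x - a)) - n1 * expR (n2 * (x - a)))
  else expR x - K1 + K2 - k1.

End call_side.

(* Main.v *)
Require Import Defs.
From HB Require Import structures.
From mathcomp Require Import all_boot all_order all_algebra.
From mathcomp Require Import all_classical all_reals all_analysis.
From mathcomp Require Import measurable_realfun.
From mathcomp Require Import ring lra.

Set Implicit Arguments.
Unset Strict Implicit.
Unset Printing Implicit Defensive.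
Import Order.TTheory GRing.Theory Num.Theory.
Import numFieldNormedType.Exports.

Local Open Scope classical_set_scope.
Local Open Scope ring_scope.

(* Smooth fit at both free boundaries gives [V_infty]. Writing [W] for its middle piece,
   [W' e^-x] is increasing and equals 1 at [b]; hence [W - e^x] decreases up to [b], which
   yields the obstacle inequalities, and beyond [b] the sign of [-L V] is that of
   [W''(b) - W'(b) > 0].

   For uniqueness let [V] and [U] be strong solutions. Then [V - U <= K1], so if [V > U]
   somewhere, [w = V - U - delta (e^(n1 x) + e^(n2 x))] has a positive global maximum for
   small [delta]; near it [V > U >= psi1], hence [L w >= 0]. This contradicts a maximum
   principle for weak derivatives, proved without regularity theory: for [v = max w - w >= 0]
   vanishing at [x0], test [A v'' + beta v' <= - c] near [x0] against smooth approximations of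
   [exp (- 1 / (h - |x - x0|))]. The adjoint operator applied to them is nonnegative except on
   a small neighborhood of [x0], whose contribution vanishes in the limit as [v x0 = 0],
   whereas the integral of the test functions stays bounded below. *)

(** * Smooth functions *)

Section smooth.
Context {R : realType}.
Implicit Types (f g df dg : R -> R) (n k : nat) (x : R).

(** Derivatives enter as existential witnesses, so closure under products, inverses and composition
    goes by induction on [n], without formulas for iterated derivatives. [smooth_derivable] returns
    to [derive1n]. *)
Fixpoint ndiff n f : Prop :=
  if n is m.+1 then exists2 g, (forall x, is_derive x 1 f (g x)) & ndiff m g
  else True.

Definition smooth f := forall n, ndiff n f.

Lemma ndiffS n f : ndiff n.+1 f -> ndiff n f.
Proof. by elim: n f => [//|n IH] f [g fg /IH]; exists g. Qed.

Lemma is_derive_derive1 f g : (forall x, is_derive x 1 f (g x)) -> derive1 f = g.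
Proof. by move=> fg; apply/funext => x; rewrite derive1E; apply: derive_val. Qed.

Lemma smooth_derivable f : smooth f -> forall n x, derivable (derive1n n f) x 1.
Proof.
move=> + n; elim: n f => [|n IH] f sf x.
  by have [g fg _] := sf 1%N; exact: ex_derive.
rewrite /derive1n iterSr; apply: IH => m.
have [g fg gm] := sf m.+1.
by rewrite (is_derive_derive1 fg).
Qed.

Lemma ndiff_cst n (c : R) : ndiff n (fun=> c).
Proof.
by elim: n c => [//|n IH] c; exists (fun=> 0) => // x; exact: is_derive_cst.
Qed.

Lemma ndiff_id n : ndiff n id.
Proof.
by case: n => // n; exists (fun=> 1); [move=> x; exact: is_derive_id|exact: ndiff_cst].
Qed.

Lemma ndiffD n f g : ndiff n f -> ndiff n g -> ndiff n (fun x => f x + g x).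
Proof.
elim: n f g => [//|n IH] f g [f' ff' nf'] [g' gg' ng'].
by exists (fun x => f' x + g' x); [move=> x; apply: is_deriveD|exact: IH].
Qed.

Lemma ndiffM n f g : ndiff n f -> ndiff n g -> ndiff n (fun x => f x * g x).
Proof.
elim: n f g => [//|n IH] f g nf ng.
have [f' ff' nf'] := nf; have [g' gg' ng'] := ng.
exists (fun x => f x * g' x + g x * f' x); first by move=> x; apply: is_deriveM.
by apply: ndiffD; apply: IH => //; exact: ndiffS.
Qed.

Lemma ndiffZ n (c : R) f : ndiff n f -> ndiff n (fun x => c * f x).
Proof. by move=> nf; apply: ndiffM => //; exact: ndiff_cst. Qed.

Lemma ndiffB n f g : ndiff n f -> ndiff n g -> ndiff n (fun x => f x - g x).
Proof.
move=> nf /(ndiffZ (-1)) /(ndiffD nf).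
by under eq_fun do rewrite mulN1r.
Qed.

(** The derivative [- f' / f ^ 2] is built from [f^-1] and [f'] by products, and [f^-1] is covered
    at the lower order by induction. *)
Lemma ndiffV n f : (forall x, f x != 0) -> ndiff n f -> ndiff n (fun x => (f x)^-1).
Proof.
move=> f0; elim: n => [//|n IH] nf; have [f' ff' nf'] := nf.
have nV := IH (ndiffS nf).
exists (fun x => -1 * ((f x)^-1 * (f x)^-1 * f' x)).
  move=> x; have [dfx dfE] := ff' x.
  apply: DeriveDef; first exact: derivableV.
  by rewrite deriveV// dfE mulN1r scaleNr -exprVn expr2.
by apply: ndiffZ; apply: ndiffM => //; exact: ndiffM.
Qed.

Lemma is_derive1_compE f g df dg x : is_derive (g x) 1 f (df (g x)) ->
  is_derive x 1 g (dg x) -> is_derive x 1 (fun x => f (g x)) (df (g x) * dg x).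
Proof. exact: is_derive1_comp. Qed.

Lemma ndiff_comp n f g : ndiff n f -> ndiff n g -> ndiff n (fun x => f (g x)).
Proof.
elim: n f g => [//|n IH] f g nf ng.
have [f' ff' nf'] := nf; have [g' gg' ng'] := ng.
exists (fun x => f' (g x) * g' x).
  by move=> x; exact: is_derive1_compE.
by apply: ndiffM => //; apply: IH => //; exact: ndiffS.
Qed.

End smooth.

(** * The flat functions [x^-k exp (- 1 / x)], extended by zero *)

Section flat.
Context {R : realType}.
Implicit Types (f g : R -> R) (k : nat) (x : R).

(** All powers [k] are kept because the derivative of [flat k] is a combination of [flat k.+2] and
    [flat k.+1]; smoothness then follows by induction on the order, for all [k] at once. *)
Definition flat k x : R := if 0 < x then x ^- k * expR (- x^-1) else 0.

Lemma flat_ge0 k x : 0 <= flat k x.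
Proof.
rewrite /flat; case: ifP => // x0.
by rewrite mulr_ge0 ?expR_ge0// invr_ge0 exprn_ge0// ltW.
Qed.

Lemma flat_le0 k x : x <= 0 -> flat k x = 0.
Proof. by rewrite /flat ltNge => ->. Qed.

Lemma flat_gt0 k x : 0 < x -> 0 < flat k x.
Proof. by move=> x0; rewrite /flat x0 mulr_gt0 ?expR_gt0// invr_gt0 exprn_gt0. Qed.

(** With [t = 1 / x] this is [t ^ k <= k! exp t], one term of the exponential series. The bound
    serves for differentiability at 0 and for the numerical constants in [peak_test_function]. *)
Lemma flat_le k x : flat k x <= k`!%:R.
Proof.
rewrite /flat; case: ifPn => [x0|_]; last exact: ler0n.
rewrite expRN ler_pdivrMr ?expR_gt0// -exprVn.
have : 0 <= x^-1 by rewrite invr_ge0 ltW.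
move: (x^-1) => t t0; case: k => [|k].
  by rewrite expr0 fact0 mul1r -expR0 ler_expR.
rewrite -ler_pdivrMl ?ltr0n ?fact_gt0// mulrC.
by rewrite (le_trans _ (expR_ge1Dxn k t0))// lerDr.
Qed.

Lemma flatS k x : flat k.+1 x * x = flat k x.
Proof.
rewrite /flat; case: ifPn => [x0|_]; last by rewrite mul0r.
by rewrite mulrAC exprSr invfM divfK// gt_eqF.
Qed.

Lemma is_derive_flat k x :
  is_derive x 1 (flat k) (flat k.+2 x - k%:R * flat k.+1 x).
Proof.
have [x0|x0|->] := ltgtP x 0.
- apply: (@near_eq_is_derive _ _ _ (fun=> 0)).
    near=> y; rewrite flat_le0//; apply: ltW; near: y; exact: lt_nbhsl.
  by rewrite !flat_le0 ?ltW// mulr0 subr0; exact: is_derive_cst.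
- apply: (@near_eq_is_derive _ _ _ (fun y : R => y ^- k * expR (- y^-1))).
    near=> y; rewrite /flat ifT//; near: y; exact: lt_nbhsr.
  have dV : is_derive x 1 (fun y : R => y^-1) (- x ^- 2).
    apply: DeriveDef; first by apply: derivableV; rewrite ?gt_eqF.
    by rewrite deriveV ?gt_eqF// derive_id /GRing.scale/= mulr1.
  have dVk : is_derive x 1 (fun y : R => y ^- k) (- k%:R * x ^- k.+1).
    rewrite (_ : (fun y => _) = (fun y : R => y^-1) ^+ k); last first.
      by apply/funext => y; rewrite -exprVn fctE.
    apply: is_derive_eq; rewrite /GRing.scale/= mulrN mulNr -exprVn; congr (- _).
    rewrite -mulrA -exprD; case: k => [|k]; first by rewrite !mul0r.
    by rewrite addn2 exprVn.
  have dE : is_derive x 1 (fun y : R => expR (- y^-1)) (expR (- x^-1) * x ^- 2).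
    apply: (@is_derive1_compE _ expR (fun y => - y^-1) expR (fun y => y ^- 2)).
    by apply: is_derive_eq; rewrite opprK.
  apply: is_derive_eq; rewrite /GRing.scale/= /flat x0.
  by rewrite -[k.+2]addn2 exprD (invfM (x ^+ k)); ring.
- rewrite !flat_le0// mulr0 subr0; apply/is_derive1_caratheodory.
  (* By [flatS] the difference quotient at 0 is [flat k.+1]; it equals [flat k.+2 z * z], whose
     first factor is bounded, and so tends to 0. *)
  exists (flat k.+1); split; last by rewrite flat_le0.
    by move=> z; rewrite (@flat_le0 k 0)// !subr0 flatS.
  rewrite /prop_for /continuous_at flat_le0//; apply/cvgr0Pnorm_le => e e0; near=> z.
  rewrite ger0_norm ?flat_ge0// -flatS.
  have [z0|z0] := leP z 0; first by rewrite (flat_le0 _ z0) mul0r ltW.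
  rewrite (@le_trans _ _ (k.+2`!%:R * z)) ?ler_pM2r ?flat_le//.
  rewrite -ler_pdivlMl ?ltr0n ?fact_gt0//; apply: ltW.
  by near: z; apply: lt_nbhsl; rewrite mulr_gt0 ?invr_gt0 ?ltr0n ?fact_gt0.
Unshelve. all: by end_near. Qed.

Lemma smooth_flat k : smooth (flat k).
Proof.
move=> n; elim: n k => [//|n IH] k.
exists (fun x => flat k.+2 x - k%:R * flat k.+1 x); first exact: is_derive_flat.
by apply: ndiffB => //; exact: ndiffZ.
Qed.

End flat.

(** * Weak derivatives *)

Section test_functions.
Context {R : realType}.
Local Notation mu := (@lebesgue_measure R).
Implicit Types (f g u phi psi : R -> R) (k : nat) (x : R).

Lemma continuous_derivable f : (forall x, derivable f x 1) -> continuous f.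
Proof. by move=> df x; exact/differentiable_continuous/derivable1_diffP. Qed.

Lemma continuous_is_derive f g : (forall x, is_derive x 1 f (g x)) -> continuous f.
Proof. by move=> df; apply: continuous_derivable => x; have [] := df x. Qed.

Lemma open_derive1n_eq0 (U : set R) phi k : open U ->
  (forall x, U x -> phi x = 0) -> forall x, U x -> derive1n k phi x = 0.
Proof.
move=> oU phi0; elim: k => [//|k IH] x Ux.
rewrite derive1nS derive1E (@near_eq_derive _ _ _ _ (cst 0)) ?derive_cst//.
have : nbhs x U by exact: open_nbhs_nbhs.
by apply: filterS => y; exact: IH.
Qed.

Lemma compact_norm_bounded (K : set R) : compact K ->
  exists M : R, forall x, K x -> `|x| <= M.
Proof.
move=> /compact_bounded [M [Mr MP]]; exists (`|M| + 1) => x Kx.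
by apply: MP => //; have := ler_norm M; lra.
Qed.

(** One radius serves all derivatives: off its closed support [phi] vanishes on an open set, hence
    so do they. *)
Lemma test_function_supp phi : test_function phi ->
  exists2 M : R, 0 < M & forall k x, M <= `|x| -> derive1n k phi x = 0.
Proof.
move=> [_ /compact_norm_bounded[M MP]].
exists (`|M| + 2); first by rewrite ltr_wpDl.
move=> k x Mx; apply: (@open_derive1n_eq0 (~` closure [set x | phi x != 0])).
- exact/closed_openC/closed_closure.
- move=> y cy; apply: contra_notP cy => /eqP py; exact: subset_closure.
- by move=> /MP; have := ler_norm M; lra.
Qed.

Lemma smooth_test_function phi (c d : R) : smooth phi ->
  (forall x, d <= `|x - c| -> phi x = 0) -> test_function phi.
Proof.
move=> sphi phi0; split; first exact: smooth_derivable.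
apply: (@subclosed_compact _ _ `[c - d, c + d]).
- exact: closed_closure.
- exact: segment_compact.
- have /closure_id -> : closed `[c - d, c + d] by apply: interval_closed.
  apply: closure_subset => x /= px; rewrite in_itv/=.
  suff : `|x - c| < d by rewrite ltr_norml => /andP[? ?]; apply/andP; split; lra.
  by rewrite ltNge; apply: contra px => /phi0 ->.
Qed.

Lemma continuous_test_function phi k : test_function phi -> continuous (derive1n k phi).
Proof. by move=> [dphi _]; exact: continuous_derivable. Qed.

Lemma is_derive_derive1n phi k x : test_function phi ->
  is_derive x 1 (derive1n k phi) (derive1n k.+1 phi x).
Proof. by move=> [dphi _]; rewrite derive1nS derive1E; exact: derivableP. Qed.

Lemma continuous_itv_bounded f (a b : R) : continuous f ->
  exists2 B : R, 0 <= B & forall x, a <= x <= b -> `|f x| <= B.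
Proof.
move=> cf; have [ab|ab] := leP a b; last first.
  by exists 0 => // x; have [ax|//] := leP a x; rewrite leNgt (lt_le_trans ab).
have [||c cab cP] := @EVT_max R (fun x => `|f x|) a b => //.
  apply: continuous_subspaceT => x.
  by apply: continuous_comp; [exact: cf|exact: norm_continuous].
by exists `|f c| => // x xab; apply: cP; rewrite in_itv.
Qed.

(** The product vanishes off [[-M, M]]; on that compact interval [u] is integrable and [psi]
    bounded. *)
Lemma integrable_loc_mul u psi (M : R) : locally_integrable setT u ->
  continuous psi -> (forall x, M <= `|x| -> psi x = 0) ->
  mu.-integrable setT (EFin \o (fun x => u x * psi x)).
Proof.
move=> [mu_ _ ui] cpsi psi0.
have -> : EFin \o (fun x => u x * psi x) =
          ((EFin \o u) \* (EFin \o psi))%E \_ `[- M, M].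
  apply/funext => x /=; rewrite patchE; case: ifPn => //.
  rewrite notin_setE/= in_itv/= -ler_norml => /negP; rewrite -ltNge => /ltW/psi0 ->.
  by rewrite mulr0.
apply/(integrable_mkcond _ _).1 => //.
apply: integrableMl => //.
- apply/integrableP; split; first exact/measurable_EFinP/measurable_funTS.
  apply: ui => //; exact: segment_compact.
- by apply: measurable_funTS; exact: continuous_measurable_fun.
- have [B B0 BP] := continuous_itv_bounded (- M) M cpsi.
  exists B; split; first exact: num_real.
  move=> C BC x /=; rewrite in_itv/= => /BP /le_trans; apply; exact: ltW.
Qed.

Lemma integrable_test u phi k : locally_integrable setT u -> test_function phi ->
  mu.-integrable setT (EFin \o (fun x => u x * derive1n k phi x)).
Proof.
move=> iu tphi; have [M _ phi0] := test_function_supp tphi.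
apply: (@integrable_loc_mul _ _ M) => //; first exact: continuous_test_function.
by move=> x; exact: phi0.
Qed.

End test_functions.

(** * Linearity of weak derivatives *)

Section weak.
Context {R : realType}.
Local Notation mu := (@lebesgue_measure R).
Implicit Types (f g u phi psi : R -> R) (k : nat) (x : R).

Lemma locally_integrableZ (c : R) u :
  locally_integrable setT u -> locally_integrable setT (fun x => c * u x).
Proof.
move=> [mu_ oT ui]; split => //; first exact: measurable_funM.
move=> K KT cK; under eq_integral do rewrite normrM EFinM.
have mK : measurable K by exact: compact_measurable.
rewrite ge0_integralZl//; first by rewrite lte_mul_pinfty//; exact: ui.
by apply/measurable_EFinP/measurable_funTS/measurableT_comp.
Qed.

Lemma weak_derivativeD k (c : R) u g v h :
  weak_derivative k u g -> weak_derivative k v h ->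
  weak_derivative k (fun x => u x + c * v x) (fun x => g x + c * h x).
Proof.
move=> [iu ig wu] [iv ih wv]; split.
- exact/locally_integrableD/locally_integrableZ.
- exact/locally_integrableD/locally_integrableZ.
move=> phi tphi.
have lin (a b : R -> R) m : locally_integrable setT a -> locally_integrable setT b ->
    \int[mu]_x ((a x + c * b x) * derive1n m phi x) =
    \int[mu]_x (a x * derive1n m phi x) + c * \int[mu]_x (b x * derive1n m phi x).
  move=> ia ib; under eq_Rintegral do rewrite mulrDl -mulrA.
  rewrite RintegralD//; last 2 first.
  - exact: integrable_test.
  - under eq_fun do rewrite mulrA.
    exact/integrable_test/tphi/locally_integrableZ.
  by rewrite RintegralZl//; exact: integrable_test.
by rewrite lin// wu// wv// (lin g h 0%N)//; ring.
Qed.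

End weak.

(** * Local integrability of locally bounded functions *)

Section locally_bounded.
Context {R : realType}.
Local Notation mu := (@lebesgue_measure R).
Implicit Types (f g : R -> R) (x : R).

(** A common sufficient condition for local integrability and [Lp_loc] which, unlike continuity,
    survives cutting off to a half-line. *)
Definition measurable_loc_bounded f :=
  measurable_fun setT f /\
  forall M : R, exists2 B : R, 0 <= B & forall x, `|x| <= M -> `|f x| <= B.

Lemma continuous_loc_bounded f : continuous f -> measurable_loc_bounded f.
Proof.
move=> cf; split; first exact: continuous_measurable_fun.
move=> M; have [B B0 BP] := continuous_itv_bounded (- M) M cf.
by exists B => // x; rewrite ler_norml => /BP.
Qed.

Lemma patch_loc_bounded f (J : set R) : measurable J -> measurable_loc_bounded f ->
  measurable_loc_bounded (f \_ J).
Proof.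
move=> mJ [mf bf]; split.
  by apply/(measurable_restrictT _ _).1 => //; exact: measurable_funTS.
move=> M; have [B B0 BP] := bf M; exists B => // x xM.
by rewrite patchE; case: ifPn => _; [exact: BP|rewrite normr0].
Qed.

Lemma loc_bounded_locally_integrable f :
  measurable_loc_bounded f -> locally_integrable setT f.
Proof.
move=> [mf bf]; split => //; first exact: openT.
move=> K _ cK; have [M KM] := compact_norm_bounded cK.
have mK : measurable K by exact: compact_measurable.
have [B B0 BP] := bf M.
apply: (@le_lt_trans _ _ (\int[mu]_(x in K) B%:E)%E).
  apply: ge0_le_integral => //.
    by apply/measurable_EFinP/measurable_funTS/measurableT_comp.
  by move=> x /KM xM; rewrite lee_fin BP.
rewrite integral_cst//= lte_mul_pinfty//; exact: compact_finite_measure.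
Qed.

Lemma loc_bounded_Lp_loc f (p : R) : 0 < p -> measurable_loc_bounded f -> Lp_loc p f.
Proof.
move=> p0 [mf bf] K cK; have [M KM] := compact_norm_bounded cK.
have mK : measurable K by exact: compact_measurable.
have [B B0 BP] := bf M.
have mfK : measurable_fun setT (f \_ K).
  by apply/(measurable_restrictT _ _).1 => //; exact: measurable_funTS.
rewrite inE; apply/andP; split; rewrite inE//=.
rewrite /finite_norm unlock /Lnorm poweR_lty//.
apply: (@le_lt_trans _ _ (\int[mu]_x ((cst (B `^ p)%:E) \_ K) x)%E).
  apply: ge0_le_integral => //.
  - by move=> x _; rewrite lee_fin powR_ge0.
  - apply/measurable_EFinP; apply: (@measurableT_comp _ _ _ _ _ _ (@powR R ^~ p)) => //.
    exact: measurableT_comp.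
  - by apply/(measurable_restrictT _ _).1; [exact: mK|exact: measurable_cst].
  - move=> x _; rewrite /= !patchE; case: ifPn => [/set_mem/KM xM|_] /=.
      rewrite lee_fin; apply: ge0_ler_powR; rewrite ?nnegrE//; first exact: ltW.
      exact: BP.
    by rewrite normr0 powR0// gt_eqF.
rewrite -integral_mkcond integral_cst//= lte_mul_pinfty ?lee_fin ?powR_ge0//.
exact: compact_finite_measure.
Qed.

End locally_bounded.

(** * Integration by parts and functions extended by zero *)

Section by_parts.
Context {R : realType}.
Local Notation mu := (@lebesgue_measure R).
Implicit Types (d phi psi : R -> R) (J Z : set R) (x s t M : R).

Lemma is_derive_LRcontinuous d (d1 : R -> R) s t : (forall x, is_derive x 1 d (d1 x)) ->
  derivable_oo_LRcontinuous d s t.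
Proof.
move=> dd; have cd := continuous_is_derive dd.
split; first by move=> x _; have [] := dd x.
- exact: cvg_at_right_filter (cd s).
- exact: cvg_at_left_filter (cd t).
Qed.

Lemma itv_by_parts d (d1 : R -> R) phi psi s t : s < t ->
  (forall x, is_derive x 1 d (d1 x)) -> continuous d1 ->
  (forall x, is_derive x 1 phi (psi x)) -> continuous psi ->
  d s * phi s = 0 -> d t * phi t = 0 ->
  \int[mu]_(x in `[s, t]) (d x * psi x) = - \int[mu]_(x in `[s, t]) (d1 x * phi x).
Proof.
move=> st dd cd1 dphi cpsi ds dt.
rewrite (@Rintegration_by_parts R d phi d1 psi s t)//.
- by rewrite ds dt subrr sub0r.
- exact: continuous_subspaceT.
- exact: is_derive_LRcontinuous.
- by move=> x _; rewrite (is_derive_derive1 dd).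
- exact: continuous_subspaceT.
- exact: is_derive_LRcontinuous.
- by move=> x _; rewrite (is_derive_derive1 dphi).
Qed.

(* [J] is an interval whose finite endpoints are closed and lie in [Z]. *)
Definition closed_ends J Z := forall M, exists s t, [/\ s < t,
  forall x, J x -> `|x| <= M -> s <= x <= t, forall x, s <= x <= t -> J x,
  Z s \/ M <= `|s| & Z t \/ M <= `|t|].

(** Both integrals reduce to [[s, t]]. The boundary terms vanish because at each end either [d] is
    zero, the end lying in [Z], or [phi] is zero, the end lying beyond [M]. *)
Lemma patch_by_parts J Z d (d1 : R -> R) phi psi M : closed_ends J Z ->
  (forall x, is_derive x 1 d (d1 x)) -> continuous d1 -> (forall x, Z x -> d x = 0) ->
  (forall x, is_derive x 1 phi (psi x)) -> continuous psi ->
  (forall x, M <= `|x| -> phi x = 0) -> (forall x, M <= `|x| -> psi x = 0) ->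
  \int[mu]_x ((d \_ J) x * psi x) = - \int[mu]_x ((d1 \_ J) x * phi x).
Proof.
move=> ends dd cd1 Zd dphi cpsi phi0 psi0.
have [s [t [st Jst stJ Zs Zt]]] := ends M.
have split (f g : R -> R) : (forall x, M <= `|x| -> g x = 0) ->
    \int[mu]_x ((f \_ J) x * g x) = \int[mu]_(x in `[s, t]) (f x * g x).
  move=> g0; rewrite [RHS]Rintegral_mkcond; apply: eq_Rintegral => x _.
  rewrite !patchE; case: ifPn => [/set_mem Jx|/negP Jx]; case: ifPn => //.
  - rewrite notin_setE/= in_itv/= => xst; rewrite g0 ?mulr0//.
    by rewrite leNgt; apply/negP => /ltW/(Jst _ Jx)/xst.
  - rewrite inE/= in_itv/= => /stJ Jx'.
    by exfalso; apply: Jx; exact/mem_set.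
  - by rewrite mul0r.
rewrite !split//; apply: itv_by_parts => //.
- by case: Zs => [/Zd ->|/phi0 ->]; rewrite ?mul0r ?mulr0.
- by case: Zt => [/Zd ->|/phi0 ->]; rewrite ?mul0r ?mulr0.
Qed.

(** Since [d] and [d1] vanish at the ends of [J], two integrations by parts leave no boundary terms;
    the second derivative may jump there. *)
Lemma W2p_patch (p : R) J Z (d d1 d2 : R -> R) : 0 < p -> measurable J -> closed_ends J Z ->
  (forall x, is_derive x 1 d (d1 x)) -> (forall x, is_derive x 1 d1 (d2 x)) ->
  continuous d2 -> (forall x, Z x -> d x = 0) -> (forall x, Z x -> d1 x = 0) ->
  W2p_loc p (d \_ J) (d1 \_ J) (d2 \_ J).
Proof.
move=> p0 mJ ends dd dd1 cd2 Zd Zd1.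
have bJ (f : R -> R) : continuous f -> measurable_loc_bounded (f \_ J).
  by move=> cf; apply: patch_loc_bounded => //; exact: continuous_loc_bounded.
have b0 := bJ d (continuous_is_derive dd).
have b1 := bJ d1 (continuous_is_derive dd1).
have b2 := bJ d2 cd2.
split; [exact: loc_bounded_Lp_loc..| |].
all: split; [exact: loc_bounded_locally_integrable..|] => phi tphi.
all: have [M _ phi0] := test_function_supp tphi.
- rewrite expr1 mulN1r; apply: (patch_by_parts ends dd _ Zd).
  + exact: continuous_is_derive dd1.
  + by move=> x; exact: (is_derive_derive1n 0).
  + exact: continuous_test_function.
  + by move=> x; exact: (phi0 0%N).
  + by move=> x; exact: phi0.
- rewrite sqrrN expr1n mul1r.
  rewrite (patch_by_parts ends dd _ Zd (fun x => is_derive_derive1n 1 x tphi) _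
    (phi0 1%N) (phi0 2))//.
  + rewrite (patch_by_parts ends dd1 cd2 Zd1 (fun x => is_derive_derive1n 0 x tphi) _
      (phi0 0%N) (phi0 1%N))//.
      by rewrite opprK.
    exact: continuous_test_function.
  + exact: continuous_is_derive dd1.
  + exact: continuous_test_function.
Qed.

Lemma W2pD (p : R) (u u1 u2 v v1 v2 : R -> R) : 1 <= p ->
  W2p_loc p u u1 u2 -> W2p_loc p v v1 v2 ->
  W2p_loc p (u \+ v) (u1 \+ v1) (u2 \+ v2).
Proof.
move=> p1 [Lu Lu1 Lu2 wu1 wu2] [Lv Lv1 Lv2 wv1 wv2].
have LD (f g : R -> R) : Lp_loc p f -> Lp_loc p g -> Lp_loc p (f \+ g).
  move=> Lf Lg K cK.
  rewrite (_ : (f \+ g) \_ K = (f \_ K) + (g \_ K)); last first.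
    by apply/funext => x; rewrite fctE !patchE; case: ifP => //; rewrite addr0.
  have p1' : (1 <= p%:E)%E by rewrite lee_fin.
  by apply: (Lfun_addr_closed mu p1').2; [exact: Lf|exact: Lg].
have E (f g : R -> R) : f \+ g = (fun x => f x + 1 * g x).
  by apply/funext => x /=; rewrite mul1r.
split; [exact: LD..| |]; rewrite !E; exact: weak_derivativeD.
Qed.

Lemma closed_endsT : closed_ends setT set0.
Proof.
move=> M; have M0 := normr_ge0 M; have MM := ler_norm M.
exists (- (`|M| + 1)), (`|M| + 1); split => //; first lra.
- by move=> x _; rewrite ler_norml => /andP[? ?]; apply/andP; split; lra.
- by right; rewrite normrN ger0_norm; lra.
- by right; rewrite ger0_norm; lra.
Qed.

Lemma closed_endsNy a : closed_ends `]-oo, a] [set a].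
Proof.
move=> M; have M0 := normr_ge0 M; have MM := ler_norm M.
have a0 := normr_ge0 a; have := ler_norm (- a); rewrite normrN => aa.
exists (- (`|M| + `|a| + 1)), a; split => //; first lra.
- move=> x /=; rewrite in_itv/= => xa; rewrite ler_norml => /andP[? ?].
  by apply/andP; split; lra.
- by move=> x /andP[_ ?]; rewrite /= in_itv.
- by right; rewrite normrN ger0_norm; lra.
- by left.
Qed.

Lemma closed_endsy b : closed_ends `[b, +oo[ [set b].
Proof.
move=> M; have M0 := normr_ge0 M; have MM := ler_norm M.
have b0 := normr_ge0 b; have bb := ler_norm b.
exists b, (`|M| + `|b| + 1); split => //; first lra.
- move=> x /=; rewrite in_itv/= andbT => xb; rewrite ler_norml => /andP[? ?].
  by apply/andP; split; lra.
- by move=> x /andP[? _]; rewrite /= in_itv/= andbT.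
- by left.
- by right; rewrite ger0_norm; lra.
Qed.

(** The case of [W2p_patch] in which [J] is the whole line, with exponent 1 as a sample value. *)
Lemma weak_derivative_smooth (d d1 d2 : R -> R) :
  (forall x, is_derive x 1 d (d1 x)) -> (forall x, is_derive x 1 d1 (d2 x)) ->
  continuous d2 -> weak_derivative 1 d d1 /\ weak_derivative 2 d d2.
Proof.
move=> dd dd1 cd2.
have [] := @W2p_patch 1 setT set0 d d1 d2 ltr01 measurableT closed_endsT
  dd dd1 cd2 _ _ => //.
by rewrite !patch_setT.
Qed.

End by_parts.

(** * The maximum principle *)

Section peak.
Context {R : realType}.
Implicit Types (t x y : R).

(** The factor after [t] is a smooth sign function: one of the two [flat] terms vanishes once
    [|t| >= 1], which makes it exactly 1 or -1. *)
Definition smooth_abs t : R :=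
  t * ((flat 0 (1 + t) - flat 0 (1 - t)) * (flat 0 (1 + t) + flat 0 (1 - t))^-1).

Lemma smooth_abs_den t : flat 0 (1 + t) + flat 0 (1 - t) != 0.
Proof.
rewrite gt_eqF//; have [t0|t0] := leP 0 t.
  by rewrite ltr_pwDl ?flat_ge0// flat_gt0//; lra.
by rewrite ltr_wpDl ?flat_ge0// flat_gt0//; lra.
Qed.

Lemma smooth_smooth_abs : smooth smooth_abs.
Proof.
move=> n.
have sD : ndiff n (fun t : R => flat 0 (1 + t)).
  apply: ndiff_comp; first exact: smooth_flat.
  by apply: ndiffD; [exact: ndiff_cst|exact: ndiff_id].
have sB : ndiff n (fun t : R => flat 0 (1 - t)).
  apply: ndiff_comp; first exact: smooth_flat.
  by apply: ndiffB; [exact: ndiff_cst|exact: ndiff_id].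
apply: ndiffM; first exact: ndiff_id.
apply: ndiffM; first exact: ndiffB.
by apply: ndiffV; [exact: smooth_abs_den|exact: ndiffD].
Qed.

Lemma smooth_absE t : 1 <= `|t| -> smooth_abs t = `|t|.
Proof.
rewrite ler_normr /smooth_abs => /orP[t1|t1].
  rewrite (flat_le0 0 (_ : 1 - t <= 0)); last lra.
  by rewrite subr0 addr0 mulfV ?mulr1 ?ger0_norm ?gt_eqF ?flat_gt0//; lra.
rewrite (flat_le0 0 (_ : 1 + t <= 0)); last lra.
by rewrite sub0r add0r mulNr mulfV ?mulrN1 ?ler0_norm ?gt_eqF ?flat_gt0//; lra.
Qed.

Lemma smooth_abs_derive : exists g1 g2 : R -> R,
  [/\ forall t, is_derive t 1 smooth_abs (g1 t), forall t, is_derive t 1 g1 (g2 t),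
      continuous g1 /\ continuous g2,
      forall t, 1 < t -> g1 t = 1 /\ g2 t = 0 &
      forall t, t < -1 -> g1 t = -1 /\ g2 t = 0].
Proof.
have [g1 dg1 [g2 dg2 [g3 dg3 _]]] := smooth_smooth_abs 3.
have uniq (f f' u : R -> R) (du t : R) (U : set R) : open U -> U t ->
    (forall s, U s -> f s = u s) -> is_derive t 1 f (f' t) ->
    is_derive t 1 u du -> f' t = du.
  move=> oU Ut fu [_ <-] [_ <-]; apply: near_eq_derive.
  have : nbhs t U by exact: open_nbhs_nbhs.
  exact: filterS.
have g1r t : 1 < t -> g1 t = 1.
  move=> t1; apply: (uniq smooth_abs g1 id 1 t `]1, +oo[%classic) => //.
  - by rewrite /= in_itv/= t1.
  - by move=> s /=; rewrite in_itv/= andbT => s1; rewrite smooth_absE ger0_norm; lra.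
have g1l t : t < -1 -> g1 t = -1.
  move=> t1; apply: (uniq smooth_abs g1 -%R (-1) t `]-oo, (-1)[%classic) => //.
  - by move=> s /=; rewrite in_itv/= => s1; rewrite smooth_absE ler0_norm; lra.
exists g1, g2; split => //.
- by split; exact: continuous_is_derive.
- move=> t t1; split; first exact: g1r.
  apply: (uniq g1 g2 (cst 1) 0 t `]1, +oo[%classic) => //.
  - by rewrite /= in_itv/= t1.
  - by move=> s /=; rewrite in_itv/= andbT => /g1r.
- move=> t t1; split; first exact: g1l.
  exact: (uniq g1 g2 (cst (-1)) 0 t `]-oo, (-1)[%classic).
Qed.

Lemma flat_ge h y : 0 < h -> h <= y -> flat 0 h <= flat 0 y.
Proof.
move=> h0 hy; have y0 := lt_le_trans h0 hy.
by rewrite /flat h0 y0 !expr0 !invr1 !mul1r ler_expR lerN2 lef_pV2.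
Qed.

(** For [F = flat 0] one has [F' = flat 2] and [F'' = flat 4 - 2 flat 3], so this says
    [A F'' >= |beta| F'] up to [h]. Dividing out [flat 4 y] by [flatS] leaves a quadratic inequality
    in [y]. *)
Lemma flat_convex (A beta h y : R) : 0 < A -> h <= 1 -> (2 * A + `|beta|) * h <= A ->
  y <= h -> `|beta| * flat 2 y <= A * (flat 4 y - 2 * flat 3 y).
Proof.
move=> A0 h1 hA yh; have [y0|y0] := leP y 0.
  by rewrite !flat_le0// !mulr0 subr0 mulr0.
rewrite -(flatS 2) -(flatS 3).
have F0 := @flat_ge0 R 4 y; move: (flat 4 y) F0 => F F0.
have b0 := normr_ge0 beta.
suff : 0 <= F * (A - (2 * A + `|beta| * y) * y) by lra.
apply: mulr_ge0 => //; rewrite subr_ge0; apply: le_trans hA.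
have y1 : y <= 1 by lra.
by apply: ler_pM; rewrite ?addr_ge0 ?mulr_ge0 ?lerD2l ?ler_piMr//; lra.
Qed.

(* As [eps] tends to 0, [phi] tends to [exp (- 1 / (h - |x - x0|))], whose kink at [x0]
   carries the only negative part of [A phi'' - beta phi']. *)
Lemma peak_test_function (A beta x0 h : R) : 0 < A -> 0 < h -> h <= 1 ->
  (2 * A + `|beta|) * h <= A ->
  exists2 B : R, 0 <= B & forall eps, 0 < eps -> eps <= h / 4 ->
  exists phi : R -> R, [/\ test_function phi, forall x, 0 <= phi x,
    forall x, h <= `|x - x0| -> phi x = 0,
    forall x, x0 + h / 4 <= x <= x0 + h / 2 -> flat 0 (h / 2) <= phi x &
    forall x, (if `|x - x0| <= eps then - (B / eps) else 0) <=
              A * derive1n 2 phi x - beta * derive1n 1 phi x].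
Proof.
move=> A0 h0 h1 hA.
have [g1 [g2 [dg dg1 [cg1 cg2] gr gl]]] := smooth_abs_derive.
have [B1 B10 BP1] := continuous_itv_bounded (-1) 1 cg1.
have [B2 B20 BP2] := continuous_itv_bounded (-1) 1 cg2.
(* From the bounds 2, 6, 24 on [flat 2], [flat 3], [flat 4]: the second derivative of [flat 0] is at
   most [24 + 2 * 6 = 36] in absolute value. Terms without a factor [1 / eps] acquire one, as
   [eps <= 1]. *)
pose B := A * (36 * B1 ^+ 2 + 2 * B2) + `|beta| * (2 * B1).
have beta0 := normr_ge0 beta.
exists B.
  by rewrite addr_ge0 ?mulr_ge0 ?addr_ge0 ?mulr_ge0 ?exprn_ge0// ltW.
move=> eps e0 eh.
(* [y] is a smooth version of [h - |x - x0|], equal to it as soon as [|x - x0| >= eps]. *)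
pose s x := (x - x0) / eps.
pose y x := h - eps * smooth_abs (s x).
pose phi x := flat 0 (y x).
have ds x : is_derive x 1 s eps^-1.
  rewrite (_ : s = (fun x => eps^-1 *: (x - x0))); last first.
    by apply/funext => z; rewrite /s mulrC.
  by apply: is_derive_eq; rewrite /GRing.scale/= subr0 mulr1.
have dgs x : is_derive x 1 (fun x => smooth_abs (s x)) (g1 (s x) * eps^-1).
  exact: (is_derive1_compE (df := g1) (dg := fun=> eps^-1)).
have dg1s x : is_derive x 1 (fun x => g1 (s x)) (g2 (s x) * eps^-1).
  exact: (is_derive1_compE (df := g2) (dg := fun=> eps^-1)).
have dy x : is_derive x 1 y (- g1 (s x)).
  apply: is_derive_eq; rewrite /GRing.scale/=.
  by field; rewrite gt_eqF.
have df0 x : is_derive x 1 (flat 0) (flat 2 x).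
  by have := is_derive_flat 0 x; rewrite mul0r subr0.
have dphi x : is_derive x 1 phi (flat 2 (y x) * - g1 (s x)).
  exact: (is_derive1_compE (df := flat 2) (dg := fun x => - g1 (s x))).
pose F2 z : R := flat 4 z - 2 * flat 3 z.
have dphi1 x : is_derive x 1 (fun x => flat 2 (y x) * - g1 (s x))
    (F2 (y x) * g1 (s x) ^+ 2 - flat 2 (y x) * g2 (s x) / eps).
  have d2 : is_derive x 1 (fun x => flat 2 (y x)) (F2 (y x) * - g1 (s x)).
    have df2 : is_derive (y x) 1 (flat 2) (F2 (y x)) := is_derive_flat 2 (y x).
    exact: (is_derive1_compE (df := F2) (dg := fun x => - g1 (s x))).
  by apply: is_derive_eq; rewrite /GRing.scale/=; ring.
have phi1E : derive1n 1 phi = fun x => flat 2 (y x) * - g1 (s x).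
  exact: is_derive_derive1.
have phi2E : derive1n 2 phi =
    fun x => F2 (y x) * g1 (s x) ^+ 2 - flat 2 (y x) * g2 (s x) / eps.
  by rewrite derive1nS phi1E; exact: is_derive_derive1.
have yE x : eps <= `|x - x0| -> y x = h - `|x - x0|.
  move=> ex; rewrite /y smooth_absE /s normrM normfV (gtr0_norm e0).
    by rewrite mulrCA mulfV ?mulr1// gt_eqF.
  by rewrite ler_pdivlMr// mul1r.
have phi0 x : h <= `|x - x0| -> phi x = 0.
  by move=> hx; rewrite /phi yE ?flat_le0//; lra.
exists phi; split => //.
- apply: smooth_test_function phi0 => n.
  apply: ndiff_comp; first exact: smooth_flat.
  apply: ndiffB; first exact: ndiff_cst.
  apply: ndiffZ; apply: ndiff_comp; first exact: smooth_smooth_abs.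
  apply: ndiffM; last exact: ndiff_cst.
  by apply: ndiffB; [exact: ndiff_id|exact: ndiff_cst].
- by move=> x; exact: flat_ge0.
- move=> x /andP[x1 x2]; have xx0 : `|x - x0| = x - x0 by rewrite ger0_norm; lra.
  by rewrite /phi yE xx0; [apply: flat_ge|]; lra.
move=> x; rewrite phi2E phi1E; case: ifPn => [xe|].
- have se : -1 <= s x <= 1.
    by rewrite -ler_norml /s normrM normfV (gtr0_norm e0) ler_pdivrMr// mul1r.
  have := BP1 _ se; have := BP2 _ se.
  move: (g1 _) (g2 _) => a b bB aB.
  have f20 := @flat_ge0 R 2 (y x); have f2 := @flat_le R 2 (y x).
  have f30 := @flat_ge0 R 3 (y x); have f3 := @flat_le R 3 (y x).
  have f40 := @flat_ge0 R 4 (y x); have f4 := @flat_le R 4 (y x).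
  rewrite /F2; move: (flat 2 _) (flat 3 _) (flat 4 _) f20 f2 f30 f3 f40 f4 => u v w.
  rewrite (_ : 2`! = 2)%N// (_ : 3`! = 6)%N// (_ : 4`! = 24)%N// => f20 f2 f30 f3 f40 f4.
  rewrite lerNl; apply: le_trans (ler_norm _) _.
  rewrite normrN; apply: le_trans (ler_normB _ _) _.
  have e1 : 1 <= eps^-1 by rewrite invf_ge1//; lra.
  have E1 : `|(w - 2 * v) * a ^+ 2| <= 36 * B1 ^+ 2 * eps^-1.
    rewrite normrM -[leLHS]mulr1; apply: ler_pM => //; rewrite ?mulr_ge0//.
    apply: ler_pM => //; first by rewrite ler_norml; apply/andP; split; lra.
    by rewrite normrX; apply: lerXn2r; rewrite ?nnegrE.
  have E2 : `|u * b / eps| <= 2 * B2 * eps^-1.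
    rewrite !normrM normfV (gtr0_norm e0) ler_pM2r ?invr_gt0//.
    by apply: ler_pM => //; rewrite ger0_norm.
  have E3 : `|u * - a| <= 2 * B1 * eps^-1.
    rewrite normrM normrN -[leLHS]mulr1; apply: ler_pM => //.
    by apply: ler_pM => //; rewrite ger0_norm.
  rewrite !(normrM A) !(normrM beta) (gtr0_norm A0).
  apply: (@le_trans _ _ (A * (36 * B1 ^+ 2 / eps + 2 * B2 / eps) +
                         `|beta| * (2 * B1 / eps))).
    apply: lerD; apply: ler_pM => //; rewrite ?(ltW A0)//.
    by apply: le_trans (ler_normB _ _) _; exact: lerD.
  by rewrite /B; lra.
(* Off the small neighborhood [g1] is 1 or -1 and [g2] is 0, so [flat_convex] gives the sign. *)
- rewrite -ltNge => ex; have yx := yE x (ltW ex).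
  have yh : y x <= h by have := normr_ge0 (x - x0); lra.
  have := @flat_convex A beta h (y x) A0 h1 hA yh; rewrite -/(F2 _).
  have f20 := @flat_ge0 R 2 (y x).
  have bl := ler_norm beta; have bl' := ler_norm (- beta); rewrite normrN in bl'.
  have [sx|sx] : 1 < s x \/ s x < -1.
    move: ex; rewrite ltr_normr => /orP[ex|ex]; [left|right].
      by rewrite /s ltr_pdivlMr// mul1r.
    by rewrite /s ltr_pdivrMr//; lra.
  + have [-> ->] := gr _ sx => H.
    have : - beta * flat 2 (y x) <= `|beta| * flat 2 (y x) by exact: ler_wpM2r.
    by lra.
  + have [-> ->] := gl _ sx => H.
    have : beta * flat 2 (y x) <= `|beta| * flat 2 (y x) by exact: ler_wpM2r.
    by lra.
Qed.

End peak.

(** * The minimum principle for weak derivatives *)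

Section minimum_principle.
Context {R : realType}.
Local Notation mu := (@lebesgue_measure R).

#[global] Instance ae_lebesgue_filter : Filter (almost_everywhere mu) :=
  ae_filter_ringOfSetsType mu.

Lemma ae_le_Rintegral (f g : R -> R) :
  mu.-integrable setT (EFin \o f) -> mu.-integrable setT (EFin \o g) ->
  {ae mu, forall x, f x <= g x} -> \int[mu]_x f x <= \int[mu]_x g x.
Proof.
move=> intf intg fg; rewrite -subr_ge0 -RintegralB//.
have mh : measurable_fun setT (fun x => g x - f x).
  by case/integrableP : intf => /measurable_EFinP mf _;
    case/integrableP : intg => /measurable_EFinP mg _; exact: measurable_funB.
(* The inequality holds only almost everywhere, so [g - f] is replaced by its positive part, which
   is nonnegative everywhere. *)
rewrite /Rintegral (@ae_eq_integral _ _ _ mu setT (fun x => (Num.max (g x - f x) 0)%:E))//.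
- by apply: fine_ge0; apply: integral_ge0 => x _; rewrite lee_fin le_max lexx orbT.
- exact/measurable_EFinP.
- by apply/measurable_EFinP; exact: measurable_maxr.
- by apply: filterS fg => x fgx _; congr EFin; rewrite max_l// subr_ge0.
Qed.

Lemma Rintegral_patch_cst (c s t : R) : s <= t ->
  mu.-integrable setT (EFin \o (cst c \_ `[s, t])) /\
  \int[mu]_x (cst c \_ `[s, t]) x = c * (t - s).
Proof.
move=> st; split.
  rewrite -restrict_EFin; apply/(integrable_mkcond _ _).1 => //.
  apply: continuous_compact_integrable; first exact: segment_compact.
  by apply: continuous_subspaceT => x; exact: cvg_cst.
have mst : mu `[s, t] = (t - s)%:E.
  rewrite lebesgue_measure_itv/= lte_fin; case: ltP => // ts.
  by rewrite (_ : t = s) ?subrr//; apply/eqP; rewrite eq_le ts st.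
rewrite -Rintegral_mkcond Rintegral_cst//; congr (_ * _).
exact: (congr1 fine mst).
Qed.

Lemma weak_minimum_principle (A beta c x0 h : R) (v v1 v2 : R -> R) :
  0 < A -> 0 < c -> 0 < h -> continuous v ->
  weak_derivative 1 v v1 -> weak_derivative 2 v v2 ->
  (forall x, 0 <= v x) -> v x0 = 0 ->
  ~ {ae mu, forall x, `|x - x0| < h -> A * v2 x + beta * v1 x <= - c}.
Proof.
move=> A0 c0 h0 cv [iv iv1 wv1] [_ iv2 wv2] v_ge0 vx0 ae_le.
have b0 := normr_ge0 beta.
(* This fraction secures both [h' <= 1] and [(2 A + |beta|) h' <= A], as the test functions
   require. *)
pose h' := Num.min h (A / (A + (2 * A + `|beta|))).
have D0 : 0 < A + (2 * A + `|beta|) by lra.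
have h'0 : 0 < h' by rewrite lt_min h0 divr_gt0.
have h'h : h' <= h by rewrite ge_min lexx.
have h'D : h' * (A + (2 * A + `|beta|)) <= A by rewrite -ler_pdivlMr// ge_min lexx orbT.
have h'1 : h' <= 1.
  by rewrite -(ler_pM2r D0) mul1r (le_trans h'D)//; lra.
have h'A : (2 * A + `|beta|) * h' <= A.
  by apply: le_trans h'D; rewrite mulrDr mulrC lerDr mulr_ge0// ltW.
have [B B0 peak] := @peak_test_function R A beta x0 h' A0 h'0 h'1 h'A.
pose k := flat 0 (h' / 2).
have k0 : 0 < k by rewrite flat_gt0// divr_gt0.
(* Chosen so that [2 * eta * B < c * k * h' / 4], which makes the two bounds on the integral below
   incompatible. *)
pose eta := c * k * h' / (16 * (B + 1)).
have B1 : 0 < 16 * (B + 1) by lra.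
have eta0 : 0 < eta by apply: divr_gt0 => //; rewrite !mulr_gt0.
have [e e0 ve] : exists2 e, 0 < e & forall x, `|x - x0| < e -> v x <= eta.
  have /cvgrPdist_le/(_ _ eta0) := cv x0; rewrite vx0 => /nbhs_ballP[e /= e0 H].
  exists e => // x xe; have := H x; rewrite /ball/= distrC => /(_ xe).
  by rewrite sub0r normrN ger0_norm.
pose eps := Num.min (e / 2) (h' / 4).
have eps0 : 0 < eps by rewrite lt_min !divr_gt0.
have epse : eps < e by rewrite (@le_lt_trans _ _ (e / 2)) ?ge_min ?lexx//; lra.
have epsh : eps <= h' / 4 by rewrite ge_min lexx orbT.
have [phi [tphi phi_ge0 phi_supp phi_lb phi_op]] := peak eps eps0 epsh.
pose L x := A * derive1n 2 phi x - beta * derive1n 1 phi x.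
have iw k' (u : R -> R) : locally_integrable setT u ->
    mu.-integrable setT (EFin \o (fun x => u x * derive1n k' phi x)).
  by move=> iu; exact: integrable_test.
have iZ (a : R) (u : R -> R) : mu.-integrable setT (EFin \o u) ->
    mu.-integrable setT (EFin \o (fun x => a * u x)).
  by move=> iu; exact: (integrableZl _ a iu).
have iD (a b : R -> R) : mu.-integrable setT (EFin \o a) ->
    mu.-integrable setT (EFin \o b) -> mu.-integrable setT (EFin \o (fun x => a x + b x)).
  by move=> ia ib; exact: (integrableD _ ia ib).
have lin (a b : R) (f g : R -> R) : mu.-integrable setT (EFin \o f) ->
    mu.-integrable setT (EFin \o g) ->
    \int[mu]_x (a * f x + b * g x) = a * \int[mu]_x f x + b * \int[mu]_x g x.
  move=> jf jg; rewrite RintegralD//; [|exact: iZ..].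
  by rewrite !RintegralZl.
have IE : \int[mu]_x (v x * L x) = \int[mu]_x ((A * v2 x + beta * v1 x) * phi x).
  transitivity (A * \int[mu]_x (v x * derive1n 2 phi x) +
                - beta * \int[mu]_x (v x * derive1n 1 phi x)).
    rewrite -lin; [|exact: iw..].
    by apply: eq_Rintegral => x _; rewrite /L; ring.
  rewrite wv1// wv2// sqrrN expr1n mul1r expr1 mulN1r mulrNN -lin.
  - by apply: eq_Rintegral => x _; ring.
  - exact: (iw 0%N).
  - exact: (iw 0%N).
have [ik Ik] := @Rintegral_patch_cst (- (c * k)) (x0 + h' / 4) (x0 + h' / 2)
  ltac:(move: h'0; clear; lra).
(* The test function is nonnegative, and at least [k] on an interval of length [h' / 4], where the
   differential expression is at most [- c]. *)
have upper : \int[mu]_x (v x * L x) <= - (c * k) * (h' / 4).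
  rewrite IE (_ : h' / 4 = x0 + h' / 2 - (x0 + h' / 4)); last by clear; lra.
  rewrite -Ik; apply: ae_le_Rintegral => //.
    rewrite (_ : (fun x => _) = (fun x => A * (v2 x * phi x) + beta * (v1 x * phi x))).
      by apply: iD; apply: iZ; exact: (iw 0%N).
    by apply/funext => x; ring.
  apply: filterS ae_le => x le_c; rewrite patchE.
  have [xh|xh] := ltP `|x - x0| h'; last first.
    rewrite phi_supp// mulr0; case: ifPn => //.
    rewrite inE/= in_itv/= => /andP[x1 x2]; move: xh x1 x2 h'0; clear.
    by rewrite ler_normr => /orP[]; lra.
  have le_phi : (A * v2 x + beta * v1 x) * phi x <= - c * phi x.
    by rewrite ler_wpM2r// le_c// (lt_le_trans xh).
  apply: le_trans le_phi _; case: ifPn => [|_].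
    rewrite inE/= in_itv/= => /phi_lb; rewrite -/k => kphi.
    by rewrite mulNr lerN2 ler_pM2l.
  by rewrite mulNr oppr_le0 mulr_ge0// ltW.
have [ie Ie] := @Rintegral_patch_cst (- (eta * (B / eps))) (x0 - eps) (x0 + eps)
  ltac:(move: eps0; clear; lra).
(* The adjoint expression can be negative only within [eps] of [x0], where it is at least
   [- B / eps] and [v <= eta]; the interval has length [2 * eps], so [eps] cancels. *)
have lower : - (eta * (B / eps)) * (eps + eps) <= \int[mu]_x (v x * L x).
  rewrite (_ : eps + eps = x0 + eps - (x0 - eps)); last by clear; ring.
  rewrite -Ie; apply: ae_le_Rintegral => //.
    rewrite (_ : (fun x => _) = (fun x => A * (v x * derive1n 2 phi x) +
                                     - beta * (v x * derive1n 1 phi x))).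
      by apply: iD; apply: iZ; exact: iw.
    by apply/funext => x; rewrite /L; ring.
  apply: aeW => x; rewrite patchE; have := phi_op x; rewrite -/(L x).
  have -> : (x \in `[x0 - eps, x0 + eps]%classic) = (`|x - x0| <= eps).
    by rewrite mem_setE in_itv/= ler_distl.
  case: ifPn => xe Lx; last by rewrite mulr_ge0.
  have Be0 : 0 <= B / eps by rewrite divr_ge0// ltW.
  apply: (@le_trans _ _ (v x * - (B / eps))); last by rewrite ler_wpM2l.
  rewrite mulrN /cst lerN2 ler_wpM2r// ve//; exact: le_lt_trans epse.
have : - (c * k) * (h' / 4) < - (eta * (B / eps)) * (eps + eps).
  rewrite (_ : - (eta * (B / eps)) * (eps + eps) = - (2 * eta * B)); last first.
    by field; rewrite gt_eqF.
  have eB : eta * (16 * (B + 1)) = c * k * h' by rewrite /eta divfK// gt_eqF.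
  have : 0 < c * k * h' by rewrite !mulr_gt0.
  by move: eB eta0; clear; lra.
by rewrite ltNge (le_trans lower upper).
Qed.

End minimum_principle.

(** * Comparison of strong solutions *)

Section comparison.
Context {R : realType}.
Local Notation mu := (@lebesgue_measure R).

Lemma is_derive_expRM (n x : R) :
  is_derive x 1 (fun x => expR (n * x)) (n * expR (n * x)).
Proof.
have dn : is_derive x 1 (fun x => n * x) n.
  by apply: is_derive_eq; rewrite /GRing.scale/=; ring.
rewrite mulrC.
exact: (is_derive1_compE (df := expR) (dg := fun=> n)).
Qed.

Lemma is_derive_expRM2 (c n x : R) :
  is_derive x 1 (fun x => c * expR (n * x)) (c * n * expR (n * x)).
Proof.
have dE := is_derive_expRM n x.
by apply: is_derive_eq; rewrite /GRing.scale/=; ring.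
Qed.

Lemma strong_solution_le (K1 k1 K2 sigma r q p n1 n2 : R) (V U : R -> R) :
  0 < K1 -> 0 < sigma -> 0 < r -> n1 < 0 -> 0 < n2 ->
  char_poly_L sigma r q n1 = 0 -> char_poly_L sigma r q n2 = 0 ->
  strong_solution K1 k1 K2 sigma r q p V -> strong_solution K1 k1 K2 sigma r q p U ->
  forall x, V x <= U x.
Proof.
move=> K10 s0 r0 n1_lt0 n2_gt0 char1 char2.
move=> [cV [V1 [V2 [[_ _ _ wV1 wV2] _ VE Vb]]]].
move=> [cU [U1 [U2 [[_ _ _ wU1 wU2] LU _ Ub]]]] z.
rewrite leNgt; apply/negP => UVz.
(* A barrier: it solves [L E = 0] and grows at both infinities, as [n1 < 0 < n2]. *)
pose E x := expR (n1 * x) + expR (n2 * x).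
pose E1 x := n1 * expR (n1 * x) + n2 * expR (n2 * x).
pose E2 x := n1 * n1 * expR (n1 * x) + n2 * n2 * expR (n2 * x).
have dE (x : R) : is_derive x 1 E (E1 x) by apply: is_deriveD; exact: is_derive_expRM.
have dE1 (x : R) : is_derive x 1 E1 (E2 x) by apply: is_deriveD; exact: is_derive_expRM2.
have cE2 : continuous E2.
  apply: (@continuous_is_derive _ _
    (fun x => n1 * n1 * n1 * expR (n1 * x) + n2 * n2 * n2 * expR (n2 * x))) => x.
  by apply: is_deriveD; exact: is_derive_expRM2.
have [wE1 wE2] := weak_derivative_smooth dE dE1 cE2.
have cE : continuous E := continuous_is_derive dE.
have Ez0 : 0 < E z by rewrite addr_gt0 ?expR_gt0.
(* Half of the gap at [z] is spent on the barrier, so that [W z = (V z - U z) / 2] stays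
   positive. *)
pose delta := (V z - U z) / (2 * E z).
have delta0 : 0 < delta by rewrite divr_gt0 ?mulr_gt0 ?subr_gt0.
pose W x := V x + (-1) * U x + (- delta) * E x.
have cW : continuous W.
  move=> x; apply: cvgD; first by apply: cvgD (cV x) (cvgMr (cU x)).
  exact: cvgMr (cE x).
have Wz : 0 < W z.
  have : delta * E z = (V z - U z) / 2 by rewrite /delta; field; rewrite gt_eqF.
  by rewrite /W; lra.
have WK x : W x <= K1 - delta * E x.
  have /andP[_ Vx] := Vb x; have /andP[Ux _] := Ub x.
  have : expR x - K1 <= Num.max (expR x - K1) 0 by rewrite le_max lexx.
  by move: Ux; rewrite /psi1 /W; lra.
(* Beyond this radius [delta * E >= K1], by [exp s >= 1 + s] applied to [n2 * x] on the right and
   [n1 * x] on the left; the term [|z|] keeps [z] inside. *)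
pose M := `|z| + K1 / (delta * n2) + K1 / (delta * - n1).
have d2 : 0 < delta * n2 by rewrite mulr_gt0.
have d1 : 0 < delta * - n1 by rewrite mulr_gt0 ?oppr_gt0.
have q2 : 0 < K1 / (delta * n2) by rewrite divr_gt0.
have q1 : 0 < K1 / (delta * - n1) by rewrite divr_gt0.
have z0 := normr_ge0 z.
have Wout x : M < `|x| -> W x <= 0.
  move=> Mx; apply: le_trans (WK x) _; rewrite subr_le0.
  have e1 := expR_gt0 (n1 * x); have e2 := expR_gt0 (n2 * x).
  have g1 := expR_ge1Dx (n1 * x); have g2 := expR_ge1Dx (n2 * x).
  move: Mx; rewrite ltr_normr => /orP[Mx|Mx].
    apply: (@le_trans _ _ (x * (delta * n2))).
      by rewrite -ler_pdivrMr// ltW//; move: Mx; rewrite /M; lra.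
    by rewrite mulrCA ler_pM2l// /E; lra.
  apply: (@le_trans _ _ ((- x) * (delta * - n1))).
    by rewrite -ler_pdivrMr// ltW//; move: Mx; rewrite /M; lra.
  by rewrite mulrCA ler_pM2l// /E; lra.
have M0 : 0 < M by rewrite /M; lra.
have [||x0 x0M Wmax] := @EVT_max R W (- M) M; [lra|exact: continuous_subspaceT|].
have Wzx0 : W z <= W x0.
  by apply: Wmax; rewrite in_itv/= -ler_norml /M; lra.
have Wx0 : 0 < W x0 by exact: lt_le_trans Wzx0.
have {}Wmax x : W x <= W x0.
  have [xM|xM] := leP `|x| M; last by rewrite (le_trans (Wout _ xM))// ltW.
  by apply: Wmax; rewrite in_itv/= -ler_norml.
have [h h0 Wh] : exists2 h, 0 < h & forall x, `|x - x0| < h -> W x0 / 2 < W x.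
  have W20 : 0 < W x0 / 2 by rewrite divr_gt0.
  have /cvgrPdist_lt/(_ _ W20) /nbhs_ballP[h /= h0 H] := cW x0.
  exists h => // x xh; have := H x; rewrite /ball/= distrC => /(_ xh).
  by rewrite ltr_norml => /andP[? ?]; lra.
have wD k (c : R) := @weak_derivativeD R k c.
have [wc1 wc2] := @weak_derivative_smooth R (fun=> W x0) (fun=> 0) (fun=> 0)
  (fun x => is_derive_cst _ x _) (fun x => is_derive_cst _ x _) (@cst_continuous _ _ 0).
(* The principle is applied to [W x0 - W], whose weak derivatives are assembled linearly from those
   of the constant, [V], [U] and [E]. *)
apply: (@weak_minimum_principle R (sigma ^+ 2 / 2) (r - q - sigma ^+ 2 / 2)
  (r * (W x0 / 2)) x0 h _ _ _ _ _ h0 _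
  (wD _ (-1) _ _ _ _ wc1 (wD _ (- delta) _ _ _ _ (wD _ (-1) _ _ _ _ wV1 wU1) wE1))
  (wD _ (-1) _ _ _ _ wc2 (wD _ (- delta) _ _ _ _ (wD _ (-1) _ _ _ _ wV2 wU2) wE2))).
- by rewrite divr_gt0 ?exprn_gt0.
- by rewrite mulr_gt0 ?divr_gt0.
- by move=> x; apply: cvgD; [exact: cvg_cst|exact: cvgMr (cW x)].
- by move=> x; rewrite mulN1r subr_ge0; exact: Wmax.
- by rewrite mulN1r; exact: subrr.
(* Near [x0] one has [W > W x0 / 2 > 0], so [V > U >= psi1] and [L V = 0]. With [L U <= 0] and
   [L E = 0] this gives [L W >= 0], and the zero-order term supplies the constant
   [r * (W x0 / 2)]. *)
apply: filterS2 VE LU => x VEx LUx xh.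
have {Wh}Wx := Wh x xh.
have Ex0 : 0 <= E x by rewrite addr_ge0 ?expR_ge0.
have UVx : psi1 K1 k1 K2 x < V x.
  have /andP[Ux _] := Ub x; apply: le_lt_trans Ux _.
  have : 0 <= delta * E x by rewrite mulr_ge0// ltW.
  by move: Wx; rewrite /W in Wx0 *; lra.
have {}VEx := VEx UVx.
have LE : sigma ^+ 2 / 2 * E2 x + (r - q - sigma ^+ 2 / 2) * E1 x = r * E x.
  move: char1 char2; rewrite /char_poly_L /E2 /E1 /E.
  move: (expR (n1 * x)) (expR (n2 * x)) => e1 e2 c1 c2.
  by have := congr1 ( *%R e1) c1; have := congr1 ( *%R e2) c2; lra.
have rW : r * (W x0 / 2) <= r * W x by rewrite ler_pM2l// ltW.
have := congr1 ( *%R delta) LE.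
move: VEx LUx rW; rewrite /Lop /W; lra.
Qed.

End comparison.

(** * The free boundary problem *)

Section smooth_fit.
Context {R : realType}.
Implicit Types (C K a b c s x y : R).

Lemma is_derive_expRMB c n s x :
  is_derive x 1 (fun x => c * expR (n * (x - s))) (c * n * expR (n * (x - s))).
Proof.
have dn : is_derive x 1 (fun x => n * (x - s)) n.
  by apply: is_derive_eq; rewrite /GRing.scale/=; ring.
have dE : is_derive x 1 (fun x => expR (n * (x - s))) (expR (n * (x - s)) * n).
  exact: (is_derive1_compE (df := expR) (dg := fun=> n)).
by apply: is_derive_eq; rewrite /GRing.scale/=; ring.
Qed.

(** The middle piece of [V_infty] for [C = K2 - k1]. The next two definitions are its derivatives,
    with a common factor pulled out that is positive by [Vmid_coef_gt0]. *)
Definition Vmid C (n1 n2 : R) a x :=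
  C / (n2 - n1) * (n2 * expR (n1 * (x - a)) - n1 * expR (n2 * (x - a))).
Definition Vmid1 C (n1 n2 : R) a x :=
  - (C * n1 * n2 / (n2 - n1)) * (expR (n2 * (x - a)) - expR (n1 * (x - a))).
Definition Vmid2 C (n1 n2 : R) a x :=
  - (C * n1 * n2 / (n2 - n1)) * (n2 * expR (n2 * (x - a)) - n1 * expR (n1 * (x - a))).

Lemma is_derive_Vmid C (n1 n2 : R) a x :
  is_derive x 1 (Vmid C n1 n2 a) (Vmid1 C n1 n2 a x).
Proof.
have d1 := is_derive_expRMB n2 n1 a x; have d2 := is_derive_expRMB n1 n2 a x.
by apply: is_derive_eq; rewrite /GRing.scale/= /Vmid1; ring.
Qed.

Lemma is_derive_Vmid1 C (n1 n2 : R) a x :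
  is_derive x 1 (Vmid1 C n1 n2 a) (Vmid2 C n1 n2 a x).
Proof.
have d1 := is_derive_expRMB 1 n1 a x; have d2 := is_derive_expRMB 1 n2 a x.
rewrite (_ : Vmid1 _ _ _ _ = fun x => - (C * n1 * n2 / (n2 - n1)) *
  (1 * expR (n2 * (x - a)) - 1 * expR (n1 * (x - a)))); last first.
  by apply/funext => z; rewrite !mul1r.
by apply: is_derive_eq; rewrite /GRing.scale/= /Vmid2; ring.
Qed.

Lemma continuous_Vmid2 C (n1 n2 : R) a : continuous (Vmid2 C n1 n2 a).
Proof.
have d1 x := is_derive_expRMB n1 n1 a x; have d2 x := is_derive_expRMB n2 n2 a x.
exact: (@continuous_is_derive _ _ (fun x => - (C * n1 * n2 / (n2 - n1)) *
  (n2 * n2 * expR (n2 * (x - a)) - n1 * n1 * expR (n1 * (x - a))))).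
Qed.

Lemma Vmid_coef_gt0 C (n1 n2 : R) : 0 < C -> n1 < 0 -> 1 <= n2 ->
  0 < - (C * n1 * n2 / (n2 - n1)).
Proof.
move=> C0 n1_lt0 n2_ge1.
rewrite (_ : - _ = C * - n1 * n2 / (n2 - n1)); last ring.
by rewrite divr_gt0 ?mulr_gt0 ?oppr_gt0 ?subr_gt0//; lra.
Qed.

Lemma Vmid_a C (n1 n2 : R) a : n1 < 0 -> 1 <= n2 -> Vmid C n1 n2 a a = C.
Proof.
move=> n1_lt0 n2_ge1; rewrite /Vmid subrr !mulr0 !expR0; field.
by rewrite subr_eq0 gt_eqF//; lra.
Qed.

Lemma Vmid1_a C (n1 n2 : R) a : Vmid1 C n1 n2 a a = 0.
Proof. by rewrite /Vmid1 subrr !mulr0 subrr mulr0. Qed.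

Lemma Vmid_increasing C (n1 n2 : R) a x y : 0 < C -> n1 < 0 -> 1 <= n2 ->
  a <= x -> x < y -> Vmid C n1 n2 a x < Vmid C n1 n2 a y.
Proof.
move=> C0 n1_lt0 n2_ge1 ax xy.
have [||c] := @MVT R (Vmid C n1 n2 a) (Vmid1 C n1 n2 a) x y xy.
- by move=> z _; exact: is_derive_Vmid.
- exact/continuous_subspaceT/(continuous_is_derive (is_derive_Vmid C n1 n2 a)).
rewrite in_itv/= => /andP[xc cy] H; rewrite -subr_gt0 H mulr_gt0 ?subr_gt0//.
rewrite mulr_gt0 ?Vmid_coef_gt0// subr_gt0 ltr_expR ltr_pM2r ?subr_gt0//; lra.
Qed.

Lemma Vmid_characteristic (A beta r : R) C (n1 n2 : R) a x :
  A * n1 ^+ 2 + beta * n1 - r = 0 -> A * n2 ^+ 2 + beta * n2 - r = 0 ->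
  A * Vmid2 C n1 n2 a x + beta * Vmid1 C n1 n2 a x = r * Vmid C n1 n2 a x.
Proof.
move=> c1 c2; rewrite /Vmid2 /Vmid1 /Vmid.
move: (expR (n1 * (x - a))) (expR (n2 * (x - a))) => e1 e2.
apply/eqP; rewrite -subr_eq0; apply/eqP.
(* Each exponential is multiplied by its own characteristic polynomial. *)
transitivity (C / (n2 - n1) * (n2 * e1 * (A * n1 ^+ 2 + beta * n1 - r) -
  n1 * e2 * (A * n2 ^+ 2 + beta * n2 - r))); first ring.
by rewrite c1 c2 !mulr0 subrr mulr0.
Qed.

(* [Vmid1 x / exp x] is increasing because [n1 - 1 < 0 <= n2 - 1]. *)
Lemma Vmid1_lt_expR C (n1 n2 : R) a b x : 0 < C -> n1 < 0 -> 1 <= n2 ->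
  Vmid1 C n1 n2 a b = expR b -> x < b -> Vmid1 C n1 n2 a x < expR x.
Proof.
move=> C0 n1_lt0 n2_ge1 fit1 xb.
have K0 := Vmid_coef_gt0 C0 n1_lt0 n2_ge1.
have E z : Vmid1 C n1 n2 a z = - (C * n1 * n2 / (n2 - n1)) *
    (expR (n2 * (z - a) - z) - expR (n1 * (z - a) - z)) * expR z.
  rewrite /Vmid1 !(expRB _ z) -[RHS]mulrA; congr (_ * _).
  by rewrite mulrBl !divfK// gt_eqF// expR_gt0.
have := fit1; rewrite E => fitb.
have eb : - (C * n1 * n2 / (n2 - n1)) *
    (expR (n2 * (b - a) - b) - expR (n1 * (b - a) - b)) = 1.
  by apply: (mulIf (lt0r_neq0 (expR_gt0 b))); rewrite fitb mul1r.
rewrite E gtr_pMl ?expR_gt0// -eb ltr_pM2l//.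
have h2 : expR (n2 * (x - a) - x) <= expR (n2 * (b - a) - b).
  by rewrite ler_expR; nra.
have h1 : expR (n1 * (b - a) - b) < expR (n1 * (x - a) - x).
  by rewrite ltr_expR; nra.
lra.
Qed.

(** Mean value theorem with [Vmid1_lt_expR]. This yields [a < ln K1], both the call part of the
    lower bound and the upper bound on [V_infty] between [a] and [b], and the final monotonicity
    claim. *)
Lemma Vmid_minus_expR_decreasing C (n1 n2 : R) a b x y : 0 < C -> n1 < 0 -> 1 <= n2 ->
  Vmid1 C n1 n2 a b = expR b -> x < y -> y <= b ->
  Vmid C n1 n2 a y - expR y < Vmid C n1 n2 a x - expR x.
Proof.
move=> C0 n1_lt0 n2_ge1 fit1 xy yb.
have dD (z : R) : is_derive z 1 (fun x => Vmid C n1 n2 a x - expR x)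
    (Vmid1 C n1 n2 a z - expR z).
  by apply: is_deriveB; exact: is_derive_Vmid.
have [|c] := @MVT R _ _ x y xy (fun z _ => dD z).
  exact/continuous_subspaceT/(continuous_is_derive dD).
rewrite in_itv/= => /andP[xc cy] H; rewrite -subr_lt0 H pmulr_llt0 ?subr_gt0//.
by rewrite subr_lt0; apply: Vmid1_lt_expR fit1 _ => //; exact: lt_le_trans yb.
Qed.

(** The difference is a positive multiple of [(n2 - 1) e2 + (1 - n1) e1], where [e1] and [e2] are
    the two exponentials. At [b] it decides the sign of [- L V] in the exercise region. *)
Lemma Vmid2_gt_Vmid1 C (n1 n2 : R) a x : 0 < C -> n1 < 0 -> 1 <= n2 ->
  Vmid1 C n1 n2 a x < Vmid2 C n1 n2 a x.
Proof.
move=> C0 n1_lt0 n2_ge1.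
rewrite -subr_gt0 /Vmid2 /Vmid1 -mulrBr mulr_gt0 ?Vmid_coef_gt0//.
have := expR_gt0 (n1 * (x - a)); have := expR_gt0 (n2 * (x - a)).
move: (expR (n1 * (x - a))) (expR (n2 * (x - a))) => e1 e2 e20 e10.
have : 0 <= (n2 - 1) * e2 by apply: mulr_ge0; [rewrite subr_ge0|exact: ltW].
have : 0 < (1 - n1) * e1 by rewrite mulr_gt0//; lra.
lra.
Qed.

End smooth_fit.

(** * The equation for the ratio of the free boundaries *)

Section free_boundary.
Context {R : realType}.

(** The characteristic polynomial takes the value [- q] at 1; factoring it gives the identity. Hence
    [n2 >= 1], strictly when [q > 0]. *)
Lemma char_poly_L_vieta (sigma r q n1 n2 : R) : 0 < sigma -> n1 < 0 -> 0 < n2 ->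
  char_poly_L sigma r q n1 = 0 -> char_poly_L sigma r q n2 = 0 ->
  sigma ^+ 2 / 2 * (1 - n1) * (n2 - 1) = q.
Proof.
rewrite /char_poly_L => s0 n1_lt0 n2_gt0 c1 c2.
move: (sigma ^+ 2 / 2) c1 c2 => A c1 c2.
have D : n2 - n1 != 0 by rewrite subr_eq0 gt_eqF//; lra.
have bE : r - q - A = - (A * (n1 + n2)).
  by apply: (mulIf D); rewrite -[RHS]addr0; lra.
have rE : r = - (A * n1 * n2).
  by move: c1; rewrite bE => c1; lra.
by lra.
Qed.

(** Under [z = exp t] powers become exponentials; the root [t] will be the width [b - a]. *)
Definition f_exp (K1 k1 K2 n1 n2 t : R) : R := f_y K1 k1 K2 n1 n2 (expR t).

Lemma f_expE (K1 k1 K2 n1 n2 t : R) : f_exp K1 k1 K2 n1 n2 t =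
  (K2 - k1) / (n2 - n1) *
    (n2 * (1 - n1) * expR (n1 * t) + n1 * (n2 - 1) * expR (n2 * t)) + (K1 + k1 - K2).
Proof. by rewrite /f_exp /f_y -!expRM (mulrC t) (mulrC t). Qed.

(** Strictness comes from the first exponential; the coefficient of the second is nonpositive and
    vanishes for [n2 = 1]. *)
Lemma f_exp_decreasing (K1 k1 K2 n1 n2 s t : R) : k1 < K2 -> n1 < 0 -> 1 <= n2 ->
  s < t -> f_exp K1 k1 K2 n1 n2 t < f_exp K1 k1 K2 n1 n2 s.
Proof.
move=> kK n1_lt0 n2_ge1 st; rewrite !f_expE ltrD2r ltr_pM2l; last first.
  by rewrite divr_gt0// subr_gt0//; lra.
apply: ltr_leD.
  by rewrite ltr_pM2l ?mulr_gt0 ?ltr_expR ?ltr_nM2l//; lra.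
apply: ler_wnM2l; first by apply: mulr_le0_ge0; lra.
by rewrite ler_expR; apply: ler_wpM2l; lra.
Qed.

(** Intermediate values: [f_exp] equals [K1 > 0] at 0, and an explicit point with a negative value
    is found in each case. *)
Lemma f_exp_root (K1 k1 K2 n1 n2 : R) : 0 < K1 -> k1 < K2 -> n1 < 0 -> 1 <= n2 ->
  1 < n2 \/ K1 + k1 < K2 -> exists2 t, 0 < t & f_exp K1 k1 K2 n1 n2 t = 0.
Proof.
move=> K10 kK n1_lt0 n2_ge1 hcase.
have D0 : 0 < n2 - n1 by lra.
have f0 : f_exp K1 k1 K2 n1 n2 0 = K1.
  by rewrite f_expE !mulr0 !expR0; field; rewrite gt_eqF.
have CD : 0 < (K2 - k1) / (n2 - n1) by rewrite divr_gt0//; lra.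
have [T T0 fT] : exists2 T, 0 < T & f_exp K1 k1 K2 n1 n2 T < 0.
  have [n2_gt1|n2_le1] := ltP 1 n2.
    pose m := - n1 * (n2 - 1).
    have m0 : 0 < m by rewrite mulr_gt0//; lra.
    have p0 : 0 < n2 * (1 - n1) by rewrite mulr_gt0//; lra.
    (* Solves the linear equation left by [exp (n1 T) <= 1] and [exp (n2 T) >= T]; then
       [f_exp T <= k1 - K2 < 0]. *)
    pose T := (n2 * (1 - n1) + K1 / ((K2 - k1) / (n2 - n1))) / m.
    have T0 : 0 < T by rewrite divr_gt0// addr_gt0// divr_gt0.
    exists T => //; rewrite f_expE.
    have e1 : expR (n1 * T) <= 1 by rewrite expR_le1 mulr_le0_ge0 ?ltW.
    have e2 : T <= expR (n2 * T).
      by apply: le_trans (expR_ge1Dx _); have := ler_wpM2r (ltW T0) n2_ge1; lra.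
    have mT : m * T = n2 * (1 - n1) + K1 / ((K2 - k1) / (n2 - n1)).
      by rewrite /T mulrC divfK// gt_eqF.
    have h : n2 * (1 - n1) * expR (n1 * T) + n1 * (n2 - 1) * expR (n2 * T) <=
        - (K1 / ((K2 - k1) / (n2 - n1))).
      have h1 : n2 * (1 - n1) * expR (n1 * T) <= n2 * (1 - n1) by rewrite ler_piMr// ltW.
      have h2 : m * T <= m * expR (n2 * T) by rewrite ler_pM2l.
      by move: h2; rewrite mT /m; lra.
    have : (K2 - k1) / (n2 - n1) *
       (n2 * (1 - n1) * expR (n1 * T) + n1 * (n2 - 1) * expR (n2 * T)) <= - K1.
      apply: le_trans (ler_wpM2l (ltW CD) h) _.
      by rewrite mulrN mulrC divfK// gt_eqF.
    lra.
  have n2E : n2 = 1 by lra.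
  have K1K : K1 < K2 - k1 by case: hcase; lra.
  (* For [n2 = 1] only [exp (n1 t)] remains, and [w] is half of its value at the root;
     [T = ln w / n1] attains it. *)
  pose w := (K2 - k1 - K1) / (2 * (K2 - k1)).
  have w0 : 0 < w by rewrite divr_gt0//; lra.
  have w1 : w < 1 by rewrite ltr_pdivrMr; lra.
  exists (ln w / n1); first by rewrite -mulrNN -invrN divr_gt0 ?oppr_gt0// ln_lt0// w0.
  rewrite f_expE n2E mulrCA mulfV ?mulr1 ?lt_eqF// lnK ?posrE// subrr mulr0 mul0r addr0.
  rewrite mul1r mulrA divfK; last by rewrite gt_eqF//; lra.
  rewrite mulrA -[X in X / _]mulrC -mulrA; set v := (K2 - k1) / _.
  have -> : v = 1 / 2 by rewrite /v; field; rewrite gt_eqF//; lra.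
  lra.
have [||t] := @IVT R (f_exp K1 k1 K2 n1 n2) 0 T 0 (ltW T0).
- apply: continuous_subspaceT.
  rewrite (_ : f_exp _ _ _ _ _ = fun t => (K2 - k1) / (n2 - n1) *
    (n2 * (1 - n1) * expR (n1 * t) + n1 * (n2 - 1) * expR (n2 * t)) + (K1 + k1 - K2)).
    move=> t; apply: cvgD; last exact: cvg_cst.
    have cE n : continuous (fun t : R => expR (n * t)).
      exact: continuous_is_derive (is_derive_expRM n).
    by apply: cvgMr; apply: cvgD; apply: cvgMr; exact: cE.
  by apply/funext => t; rewrite f_expE.
- by rewrite f0 ge_min le_max (ltW fT) (ltW K10) orbT.
rewrite in_itv/= => /andP[t0 _] ft; exists t => //.
rewrite lt_neqAle t0 andbT; apply/eqP => t0E.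
by move: ft; rewrite -t0E f0 => /eqP; rewrite gt_eqF.
Qed.

End free_boundary.

(** * Continuity and Sobolev regularity of [V_infty] *)

Section V_infty_facts.
Context {R : realType}.
Local Notation mu := (@lebesgue_measure R).

(** Matching values at [a] and [b] let each formula hold on its closed piece, whatever the
    strictness of the tests in the definition. *)
Lemma V_infty_pieces (K1 k1 K2 n1 n2 a b : R) : a < b -> n1 < 0 -> 1 <= n2 ->
  Vmid (K2 - k1) n1 n2 a b = expR b - K1 + (K2 - k1) ->
  [/\ forall x, x <= a -> V_infty K1 k1 K2 n1 n2 a b x = K2 - k1,
      forall x, a <= x <= b -> V_infty K1 k1 K2 n1 n2 a b x = Vmid (K2 - k1) n1 n2 a x &
      forall x, b <= x -> V_infty K1 k1 K2 n1 n2 a b x = expR x - K1 + K2 - k1].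
Proof.
move=> ab n1_lt0 n2_ge1 fit; rewrite /V_infty; split=> x.
- rewrite le_eqVlt => /predU1P[->|->//]; rewrite ltxx ltW//.
  exact: (Vmid_a (K2 - k1) a n1_lt0 n2_ge1).
- by move=> /andP[ax xb]; rewrite ltNge ax xb.
- rewrite le_eqVlt => /predU1P[<-|bx]; last first.
    by rewrite ltNge (ltW (lt_trans ab bx)) leNgt bx.
  rewrite lexx ltNge (ltW ab)/=.
  by rewrite -[LHS]/(Vmid (K2 - k1) n1 n2 a b) fit; lra.
Qed.

Lemma psi1_le (K1 k1 K2 x : R) : expR x <= K1 -> psi1 K1 k1 K2 x = K2 - k1.
Proof. by move=> xK; rewrite /psi1 max_r ?add0r// subr_le0. Qed.

Lemma psi1_ge (K1 k1 K2 x : R) : K1 <= expR x -> psi1 K1 k1 K2 x = expR x - K1 + K2 - k1.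
Proof. by move=> xK; rewrite /psi1 max_l// subr_ge0. Qed.

Lemma continuous_V_infty (K1 k1 K2 n1 n2 a b : R) : a < b -> n1 < 0 -> 1 <= n2 ->
  Vmid (K2 - k1) n1 n2 a b = expR b - K1 + (K2 - k1) ->
  continuous (V_infty K1 k1 K2 n1 n2 a b).
Proof.
move=> ab n1_lt0 n2_ge1 fit.
have [Va Vab Vb] := V_infty_pieces ab n1_lt0 n2_ge1 fit.
(* Clamping the argument to [[a, b]] and adding the excess of the exponential beyond [b] turns the
   gluing into a composition of continuous maps. *)
have -> : V_infty K1 k1 K2 n1 n2 a b = fun x : R =>
    Vmid (K2 - k1) n1 n2 a (Num.max a (Num.min x b)) + (expR (Num.max x b) - expR b).
  apply/funext => x; have [xa|ax] := leP x a.
    have xb : x <= b by rewrite (le_trans xa) ?ltW.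
    by rewrite Va// min_l// max_l// max_r// subrr addr0 Vmid_a.
  have [xb|bx] := leP x b.
    by rewrite Vab ?(ltW ax) ?xb// (max_r (ltW ax)) subrr addr0.
  by rewrite Vb ?(ltW bx)// (max_r (ltW ab)) fit; lra.
have cmin : continuous (fun x : R => Num.max a (Num.min x b)).
  move=> x; apply: (@continuous_max _ _ (cst a) (fun x : R => Num.min x b)).
    exact: cvg_cst.
  by apply: (@continuous_min _ _ (fun x : R => x) (cst b)); [exact: cvg_id|exact: cvg_cst].
have cmax : continuous (fun x : R => Num.max x b).
  move=> x; apply: (@continuous_max _ _ (fun x : R => x) (cst b)).
    exact: cvg_id.
  exact: cvg_cst.
have cV := continuous_is_derive (is_derive_Vmid (K2 - k1) n1 n2 a).
move=> x; apply: cvgD.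
  exact: (continuous_comp (cmin x) (cV _)).
apply: cvgB; last exact: cvg_cst.
exact: (continuous_comp (cmax x) (@continuous_expR R _)).
Qed.

(* [V_infty] is the smooth [Vmid] corrected on each half-line by a smooth function
   vanishing to second order at the free boundary. *)
Lemma V_infty_W2p (K1 k1 K2 n1 n2 a b p : R) : a < b -> n1 < 0 -> 1 <= n2 -> 1 <= p ->
  Vmid (K2 - k1) n1 n2 a b = expR b - K1 + (K2 - k1) ->
  Vmid1 (K2 - k1) n1 n2 a b = expR b ->
  exists V1 V2 : R -> R, [/\ W2p_loc p (V_infty K1 k1 K2 n1 n2 a b) V1 V2,
    forall x, x <= a -> V1 x = 0 /\ V2 x = 0,
    forall x, a < x < b -> V1 x = Vmid1 (K2 - k1) n1 n2 a x /\
                           V2 x = Vmid2 (K2 - k1) n1 n2 a x &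
    forall x, b <= x -> V1 x = expR x /\ V2 x = expR x].
Proof.
move=> ab n1_lt0 n2_ge1 p1 fit fit1.
have [Va Vab Vb] := V_infty_pieces ab n1_lt0 n2_ge1 fit.
have p0 : 0 < p := lt_le_trans ltr01 p1.
set C := K2 - k1 in fit fit1 Va Vab *.
pose W := Vmid C n1 n2 a; pose W1 := Vmid1 C n1 n2 a; pose W2 := Vmid2 C n1 n2 a.
have dW (x : R) : is_derive x 1 W (W1 x) := is_derive_Vmid C n1 n2 a x.
have dW1 (x : R) : is_derive x 1 W1 (W2 x) := is_derive_Vmid1 C n1 n2 a x.
have cW2 : continuous W2 := @continuous_Vmid2 R C n1 n2 a.
pose l x := C - W x; pose l1 x := 0 - W1 x; pose l2 x := 0 - W2 x.
pose u x := expR x - K1 + C - W x; pose u1 x := expR x - W1 x; pose u2 x := expR x - W2 x.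
have dl (x : R) : is_derive x 1 l (l1 x) by apply: is_deriveB.
have dl1 (x : R) : is_derive x 1 l1 (l2 x) by apply: is_deriveB.
have cl2 : continuous l2 by move=> x; apply: cvgB; [exact: cvg_cst|exact: cW2].
have du (x : R) : is_derive x 1 u (u1 x).
  apply: is_deriveB; rewrite (_ : (fun x => _) = (fun x => expR x - (K1 - C))).
    by apply: is_derive_eq; rewrite oppr0 addr0.
  by apply/funext => z; ring.
have du1 (x : R) : is_derive x 1 u1 (u2 x) by apply: is_deriveB.
have cu2 : continuous u2 by move=> x; apply: cvgB; [exact: continuous_expR|exact: cW2].
have W0 := @W2p_patch R p setT set0 W W1 W2 p0 measurableT (@closed_endsT R) dW dW1 cW2
  (fun x (x0 : set0 x) => False_ind _ x0) (fun x (x0 : set0 x) => False_ind _ x0).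
have Wl := @W2p_patch R p `]-oo, a]%classic [set a] l l1 l2 p0
  ltac:(exact: measurable_itv) (closed_endsNy a) dl dl1 cl2
  ltac:(by move=> x /= ->; rewrite /l /W Vmid_a// subrr)
  ltac:(by move=> x /= ->; rewrite /l1 /W1 Vmid1_a subrr).
have Wu := @W2p_patch R p `[b, +oo[%classic [set b] u u1 u2 p0
  ltac:(exact: measurable_itv) (closed_endsy b) du du1 cu2
  ltac:(by move=> x /= ->; rewrite /u /W fit subrr)
  ltac:(by move=> x /= ->; rewrite /u1 /W1 fit1 subrr).
have pat (f g h : R -> R) x :
    ((f \_ setT \+ g \_ `]-oo, a]%classic) \+ h \_ `[b, +oo[%classic) x =
    f x + (if x <= a then g x else 0) + (if b <= x then h x else 0).
  by rewrite /= !patchE in_setT !mem_setE !in_itv/= andbT.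
exists ((W1 \_ setT \+ l1 \_ `]-oo, a]%classic) \+ u1 \_ `[b, +oo[%classic).
exists ((W2 \_ setT \+ l2 \_ `]-oo, a]%classic) \+ u2 \_ `[b, +oo[%classic).
split.
- rewrite (_ : V_infty _ _ _ _ _ _ _ =
    (W \_ setT \+ l \_ `]-oo, a]%classic) \+ u \_ `[b, +oo[%classic).
    exact/W2pD/Wu/W2pD.
  apply/funext => x; rewrite pat; have [xa|ax] := leP x a.
    by rewrite Va// leNgt (le_lt_trans xa ab)/= /l; ring.
  have [bx|xb] := leP b x; first by rewrite Vb// /u /C; ring.
  by rewrite Vab ?(ltW ax) ?(ltW xb)// !addr0.
- move=> x xa; rewrite !pat xa leNgt (le_lt_trans xa ab)/= /l1 /l2.
  by split; ring.
- move=> x /andP[ax xb]; rewrite !pat (leNgt x a) ax (leNgt b x) xb/=.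
  by rewrite !addr0.
- move=> x bx; rewrite !pat bx leNgt (lt_le_trans ab bx)/= /u1 /u2.
  by split; ring.
Qed.

End V_infty_facts.

(** * Verification of the solution and uniqueness *)

Theorem theorem5p2 (R : realType) (K1 k1 k2 K2 sigma r q p n1 n2 : R)
    (hK1 : 0 < K1) (hK1k1 : K1 < k1) (hk1k2 : k1 < k2) (hk2K2 : k2 < K2)
    (hsigma : 0 < sigma) (hr : 0 < r) (hq : 0 <= q) (hp : 1 < p)
    (hn1 : n1 < 0) (hn2 : 0 < n2)
    (hn1_root : char_poly_L sigma r q n1 = 0)
    (hn2_root : char_poly_L sigma r q n2 = 0)
    (hcase : 0 < q \/ (q = 0 /\ K1 + k1 < K2)) :
  exists y : R,
    [/\ 1 < y,
        f_y K1 k1 K2 n1 n2 y = 0 &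
        forall z, 1 < z -> f_y K1 k1 K2 n1 n2 z = 0 -> z = y] /\
  exists a b : R,
    [/\ expR b = (K2 - k1) * n1 * n2 / (n2 - n1) * (y `^ n1 - y `^ n2),
        expR a = expR b / y &
        a < b] /\
    [/\ a < ln K1 /\ ln K1 < b,
        strong_solution K1 k1 K2 sigma r q p (V_infty K1 k1 K2 n1 n2 a b),
        forall V : R -> R, strong_solution K1 k1 K2 sigma r q p V ->
          V = V_infty K1 k1 K2 n1 n2 a b,
        [set x | V_infty K1 k1 K2 n1 n2 a b x = psi1 K1 k1 K2 x] =
          `]-oo, a] `|` `[b, +oo[ &
        forall x1 x2, ln K1 <= x1 -> x1 < x2 -> x2 <= b ->
          V_infty K1 k1 K2 n1 n2 a b x2 - psi1 K1 k1 K2 x2 <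
          V_infty K1 k1 K2 n1 n2 a b x1 - psi1 K1 k1 K2 x1].
Proof.
have kK : k1 < K2 := lt_trans hk1k2 hk2K2.
have C0 : 0 < K2 - k1 by rewrite subr_gt0.
have A0 : 0 < sigma ^+ 2 / 2 by rewrite divr_gt0 ?exprn_gt0.
have vieta := char_poly_L_vieta hsigma hn1 hn2 hn1_root hn2_root.
have An1 : 0 < sigma ^+ 2 / 2 * (1 - n1) by rewrite mulr_gt0//; lra.
have n2_ge1 : 1 <= n2 by rewrite -subr_ge0 -(pmulr_rge0 _ An1) vieta.
have [t t0 ft] : exists2 t, 0 < t & f_exp K1 k1 K2 n1 n2 t = 0.
  apply: f_exp_root => //; case: hcase => [q0|[_ ?]]; last by right.
  by left; rewrite -subr_gt0 -(pmulr_rgt0 _ An1) vieta.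
have K0 := Vmid_coef_gt0 C0 hn1 n2_ge1.
have et12 : expR (n1 * t) < expR (n2 * t) by rewrite ltr_expR ltr_pM2r//; lra.
(* The slope of the middle piece at distance [t] from [a]. It depends on [t] alone, so slope
   matching fixes [exp b = g], and then [a = b - t]. *)
pose g := - ((K2 - k1) * n1 * n2 / (n2 - n1)) * (expR (n2 * t) - expR (n1 * t)).
have g0 : 0 < g by rewrite mulr_gt0 ?subr_gt0.
exists (expR t); split.
  split; [by rewrite expR_gt1|by []|].
  move=> z z1 fz; have z0 : 0 < z := lt_trans ltr01 z1.
  have zE : expR (ln z) = z by rewrite lnK// posrE.
  have [lt|lt|<-] := ltgtP (ln z) t; last by rewrite zE.
    by have := f_exp_decreasing K1 kK hn1 n2_ge1 lt; rewrite ft /f_exp zE fz ltxx.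
  by have := f_exp_decreasing K1 kK hn1 n2_ge1 lt; rewrite ft /f_exp zE fz ltxx.
pose b := ln g; pose a := b - t.
have eb : expR b = g by rewrite lnK// posrE.
have ab : a < b by rewrite /a; lra.
have bat : b - a = t by rewrite /a; lra.
have fit1 : Vmid1 (K2 - k1) n1 n2 a b = expR b by rewrite eb /Vmid1 bat.
have fit : Vmid (K2 - k1) n1 n2 a b = expR b - K1 + (K2 - k1).
  (* Given the slope at [b], the equation [f_exp t = 0] is exactly value matching at [b]. *)
  have : Vmid (K2 - k1) n1 n2 a b - Vmid1 (K2 - k1) n1 n2 a b =
         f_exp K1 k1 K2 n1 n2 t - (K1 + k1 - K2).
    by rewrite f_expE /Vmid /Vmid1 bat; ring.
  by rewrite ft fit1; lra.
have Vaa := Vmid_a (K2 - k1) a hn1 n2_ge1.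
have aK : expR a < K1.
  have := Vmid_minus_expR_decreasing C0 hn1 n2_ge1 fit1 ab (lexx b).
  by rewrite fit Vaa; lra.
have Kb : K1 < expR b.
  have := Vmid_increasing C0 hn1 n2_ge1 (lexx a) ab.
  by rewrite fit Vaa; lra.
have [Va Vab Vb] := V_infty_pieces ab hn1 n2_ge1 fit.
have psia x : x <= a -> psi1 K1 k1 K2 x = K2 - k1.
  by move=> xa; apply: psi1_le; rewrite (le_trans _ (ltW aK))// ler_expR.
have psib x : b <= x -> psi1 K1 k1 K2 x = expR x - K1 + K2 - k1.
  by move=> bx; apply: psi1_ge; rewrite (le_trans (ltW Kb))// ler_expR.
have psiab x : a < x < b -> psi1 K1 k1 K2 x < V_infty K1 k1 K2 n1 n2 a b x.
  move=> /andP[ax xb]; rewrite Vab ?(ltW ax) ?(ltW xb)//.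
  have h1 := Vmid_increasing C0 hn1 n2_ge1 (lexx a) ax.
  have h2 := Vmid_minus_expR_decreasing C0 hn1 n2_ge1 fit1 xb (lexx b).
  have : Num.max (expR x - K1) 0 < Vmid (K2 - k1) n1 n2 a x - (K2 - k1).
    by rewrite gt_max; apply/andP; split; move: h1 h2; rewrite fit Vaa; lra.
  by rewrite /psi1; lra.
exists a, b; split.
  split => //; last by rewrite /a expRB.
  by rewrite eb /g -!expRM (mulrC t) (mulrC t); ring.
have sV : strong_solution K1 k1 K2 sigma r q p (V_infty K1 k1 K2 n1 n2 a b).
  split; first exact: continuous_V_infty.
  have [V1 [V2 [VW V12a V12ab V12b]]] := V_infty_W2p ab hn1 n2_ge1 (ltW hp) fit fit1.
  have LW x := Vmid_characteristic (K2 - k1) a x hn1_root hn2_root.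
  have Lab x : a < x < b -> Lop sigma r q (V_infty K1 k1 K2 n1 n2 a b) V1 V2 x = 0.
    move=> xab; have [V1x V2x] := V12ab x xab; have /andP[ax xb] := xab.
    by rewrite /Lop V1x V2x Vab ?(ltW ax) ?(ltW xb)// LW subrr.
  exists V1, V2; split => //.
  - apply: aeW => x; have [xa|ax] := leP x a.
      have [V1x V2x] := V12a x xa; rewrite /Lop V1x V2x Va//.
      by rewrite !mulr0 addr0 sub0r opprK mulr_ge0// ltW.
    have [bx|xb] := leP b x; last by rewrite Lab ?oppr0// ax.
    have [V1x V2x] := V12b x bx; rewrite /Lop V1x V2x Vb//.
    (* Here [- L V = q exp x + r (K2 - k1 - K1)]. At [b] the equation of the middle piece makes this
       [sigma ^ 2 / 2] times [Vmid2 b - exp b > 0], and [q exp x] does not decrease beyond [b]. *)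
    have Wb := Vmid2_gt_Vmid1 a b C0 hn1 n2_ge1.
    have := LW b; rewrite fit1 fit => LWb; rewrite fit1 in Wb.
    have h1 : 0 < sigma ^+ 2 / 2 * (Vmid2 (K2 - k1) n1 n2 a b - expR b).
      by rewrite mulr_gt0 ?subr_gt0.
    have h2 : q * expR b <= q * expR x by rewrite ler_wpM2l// ler_expR.
    by lra.
  - apply: aeW => x Vx; have [xa|ax] := leP x a.
      by move: Vx; rewrite Va// psia// ltxx.
    have [bx|xb] := leP b x; last by rewrite Lab ?oppr0// ax.
    by move: Vx; rewrite Vb// psib// ltxx.
  - move=> x; have [xa|ax] := leP x a.
      by rewrite Va// psia// lexx/=; have := expR_gt0 x; lra.
    have [bx|xb] := leP b x; first by rewrite Vb// psib// lexx/=; lra.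
    rewrite ltW ?psiab ?ax//= Vab ?(ltW ax) ?(ltW xb)//.
    have := Vmid_minus_expR_decreasing C0 hn1 n2_ge1 fit1 ax (ltW xb).
    by have := expR_gt0 a; rewrite Vaa; lra.
have lnK1 : expR (ln K1) = K1 by rewrite lnK// posrE.
have alnK : a < ln K1 by rewrite -ltr_expR lnK1.
have lnKb : ln K1 < b by rewrite -ltr_expR lnK1.
split => //.
- move=> V sV'; apply/funext => x; apply/eqP; rewrite eq_le.
  have cmp := strong_solution_le hK1 hsigma hr hn1 hn2 hn1_root hn2_root.
  by rewrite (cmp _ _ _ _ _ sV' sV) (cmp _ _ _ _ _ sV sV').
- apply/seteqP; split => x /=; rewrite !in_itv/= andbT.
    move=> Vx; have [xa|ax] := leP x a; first by left.
    have [bx|xb] := leP b x; first by right.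
    by have := psiab x; rewrite Vx ltxx ax xb => /(_ isT).
  by case=> [xa|bx]; [rewrite Va// psia|rewrite Vb// psib].
- move=> x1 x2 x1K x12 x2b.
  have x1b := ltW (lt_le_trans x12 x2b).
  have ax1 := ltW (lt_le_trans alnK x1K); have ax2 := le_trans ax1 (ltW x12).
  have x2K := le_trans x1K (ltW x12).
  rewrite !Vab ?ax1 ?ax2//.
  have psiE x : ln K1 <= x -> psi1 K1 k1 K2 x = expR x - K1 + K2 - k1.
    by move=> Kx; apply: psi1_ge; rewrite -[leLHS]lnK1 ler_expR.
  rewrite !psiE//.
  have := Vmid_minus_expR_decreasing C0 hn1 n2_ge1 fit1 x12 x2b.
  by lra.
Qed.
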